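(* Let $(\lambda_n)$ be a sequence of positive reals with $\lambda_n\to\infty$ (arbitrarily slowly) and $\lambda_n\ll n^{1/3}$. Then $\mathcal{G}\big(n,p=2(1+\lambda_n n^{-1/3})/n,2\big)$ is w.h.p. not adaptably $2$-colorable.
   Context: For a finite simple graph $G=(V,E)$ with a (not necessarily proper) edge coloring $c:E\to\{red,blue\}$, a vertex coloring $\sigma:V\to\{red,blue\}$ is adapted to $c$ if for every edge $uv\in E$ either $\sigma(u)\neq c(uv)$ or $\sigma(v)\ne c(uv)$. The pair $(G,c)$ is adaptably $2$-colorable if there exists a vertex coloring adapted to $c$. $\mathcal{G}(n,p,2)$ is the random pair $(G,c)$ in which each possible edge on $n$ labelled vertices is included independently with probability $p$ (it is understood that $p\in[0,1]$), and each included edge is independently assigned a uniformly random color from $\{red,blue\}$. A sequence of events $A_n$ occurs w.h.p. if $\mathbb{P}[A_n]\to 1$ as $n\to\infty$. The notation $a_n\ll b_n$ means $a_n/b_n\to0$. ''Arbitrarily slowly'' means that no lower bound on the growth rate of $\lambda_n$ is imposed. *)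

(* Defs.v *)
From mathcomp Require Import all_boot all_order all_algebra.
From mathcomp Require Import all_classical all_reals all_analysis.

Set Implicit Arguments.
Unset Strict Implicit.
Unset Printing Implicit Defensive.

Import Order.TTheory GRing.Theory Num.Theory.
Local Open Scope ring_scope.

(* The two colors: [true] is red and [false] is blue. *)
Definition color := bool.

(* The possible edges on [V]: unordered pairs of distinct vertices. *)
Definition vpair (V : finType) := {e : {set V} | #|e| == 2}.

(* A finite simple graph on [V] together with an edge coloring, i.e. a pair
   (G, c): [w e = None] means that [e] is not an edge of G, and [w e = Some k]
   means that [e] is an edge of G with c(e) = k. *)
Definition edge_colored_graph (V : finType) := {ffun vpair V -> option color}.

(* [Some c(uv)] if uv is an edge, [None] otherwise (in particular if u = v). *)
Definition edge_color (V : finType) (w : edge_colored_graph V) (u v : V) :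
  option color := obind w (insub [set u; v]%SET).

Definition adapted (V : finType) (w : edge_colored_graph V)
    (sigma : {ffun V -> color}) : bool :=
  [forall u, forall v,
     if edge_color w u v is Some k then (sigma u != k) || (sigma v != k)
     else true].

Definition adaptably_2colorable (V : finType) (w : edge_colored_graph V) :
  bool := [exists sigma, adapted w sigma].

(* Law of the state of one potential edge: absent with probability 1 - p,
   otherwise red or blue with probability 1/2 each. *)
Definition edge_law (R : realType) (p : R) (s : option color) : R :=
  if s is Some _ then p / 2 else 1 - p.

(* Probability of the event [A] under G(n, p, 2): the states of the potential
   edges are independent. Meaningful as a probability for p in [0, 1]. *)
Definition Pr_Gnp2 (R : realType) (n : nat) (p : R)
    (A : pred (edge_colored_graph 'I_n)) : R :=
  \sum_(w : edge_colored_graph 'I_n | A w) \prod_(e : vpair 'I_n) edge_law p (w e).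

Lemma Pr_Gnp2_ge0 (R : realType) (n : nat) (p : R)
    (A : pred (edge_colored_graph 'I_n)) : 0 <= p <= 1 -> 0 <= Pr_Gnp2 p A.
Proof.
move=> /andP[p0 p1]; apply: sumr_ge0 => w _; apply: prodr_ge0 => e _.
by case: (w e) => [k|] /=; rewrite ?divr_ge0 ?subr_ge0.
Qed.

Lemma Pr_Gnp2_total (R : realType) (n : nat) (p : R) :
  Pr_Gnp2 p (fun _ : edge_colored_graph 'I_n => true) = 1.
Proof.
rewrite /Pr_Gnp2 -(bigA_distr_bigA (fun _ s => edge_law p s)) big1 // => e _.
rewrite (bigD1 None) //= (bigD1 (Some true)) //= (bigD1 (Some false)) //=.
rewrite big1 ?addr0; last by case=> [[]|].
by rewrite -splitr subrK.
Qed.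

(* Main.v *)
Require Import Defs.
From mathcomp Require Import all_boot all_order all_algebra.
From mathcomp Require Import all_classical all_reals all_analysis.
From mathcomp Require Import ring lra zify.
Import Order.TTheory GRing.Theory Num.Theory.
Import numFieldNormedType.Exports.

(** An adapted coloring is a satisfying assignment of the 2-SAT instance in
    which an edge uv of color c forbids sigma(u) = sigma(v) = c, so a walk with
    alternating colors propagates the color of its first vertex. A dumbbell,
    that is two odd alternating closed walks whose end steps are red, joined by
    an odd alternating path whose end steps are blue, is therefore an
    obstruction, and it has one more edge than vertices.

    Put eps = lambda n^(-1/3). The number X of dumbbells whose three legs have
    length of order T = n^(1/3) lambda^(-1/2) has
    E X ~ (1 + eps)^(6 T) T^3 / n, up to constants, which tends to infinity.
    For the second moment, fix a dumbbell D and sum over all dumbbells D' the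
    weight p/2 = (1 + eps)/n per edge outside D and 1 per edge of D. Dropping
    the injectivity of D', this sum factors through powers of the transfer
    matrix with entries (1 + eps)/n + [edge of D]. An alternating walk inside D
    is deterministic except at the two junctions of D, so there are at most two
    such walks of each length at most 4 T from a given vertex; hence runs inside
    D contribute O(1/eps) per vertex of D, and the excess over (E X) is governed
    by T^3/n = lambda^(-3/2), T/(n eps^2), 1/(n eps^3) and 1/(eps T), which all
    tend to 0. *)

Set Implicit Arguments.
Unset Strict Implicit.
Unset Printing Implicit Defensive.
Local Open Scope ring_scope.

(** * The second moment method in G(n, p, 2) *)

Notation colored_edge V := ({set V} * bool)%type.

Definition present (V : finType) (w : edge_colored_graph V)
    (x : colored_edge V) : bool := obind w (insub x.1) == Some x.2.

(** Uniqueness is asked of the uncolored pairs, so that the entries concern different potential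
    edges and are independent. *)
Definition edge_list (V : finType) (es : seq (colored_edge V)) : bool :=
  all (fun x : colored_edge V => #|x.1| == 2) es && uniq (unzip1 es).

Lemma presentE (V : finType) (w : edge_colored_graph V) (x : colored_edge V) (e : vpair V) :
  x.1 = val e -> present w x = (w e == Some x.2).
Proof. by move=> xe; rewrite /present xe valK. Qed.

Section Probability.
Variables (R : realType) (n : nat) (p : R).
Hypothesis p01 : 0 <= p <= 1.
Notation graph := (edge_colored_graph 'I_n).

Definition mass (w : graph) : R := \prod_(e : vpair 'I_n) edge_law p (w e).

Lemma mass_ge0 w : 0 <= mass w.
Proof.
move/andP: p01 => [p0 p1]; apply: prodr_ge0 => e _.
by case: (w e) => [k|] /=; rewrite ?divr_ge0 ?subr_ge0.
Qed.

Lemma sum_option (F : option color -> R) :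
  \sum_s F s = F None + F (Some true) + F (Some false).
Proof.
rewrite (bigD1 None) //= (bigD1 (Some true)) //= (bigD1 (Some false)) //=.
by rewrite big1 ?addr0 ?addrA //; case=> [[]|].
Qed.

Lemma edge_prod (F : R) (x : colored_edge 'I_n) : #|x.1| == 2 ->
  \prod_(e : vpair 'I_n | x.1 == val e) F = F.
Proof.
by move=> x2; rewrite (big_pred1 (Sub x.1 x2 : vpair 'I_n)).
Qed.

(** Independence: the indicator is a product over potential edges, so the sum over graphs
    distributes into a product of sums over the states of one edge. A listed edge gives [p / 2], any
    other gives total mass 1. *)
Lemma Pr_all_present es : edge_list es ->
  Pr_Gnp2 p (fun w : graph => all (present w) es) = (p / 2) ^+ size es.
Proof.
case/andP=> es2 ues.
pose F (e : vpair 'I_n) s :=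
  edge_law p s * \prod_(x <- es | x.1 == val e) (s == Some x.2)%:R.
have -> : Pr_Gnp2 p (fun w : graph => all (present w) es)
    = \sum_(w : graph) \prod_e F e (w e).
  rewrite /Pr_Gnp2 big_mkcond; apply: eq_bigr => w _.
  rewrite big_split /= (exchange_big_dep predT) //=.
  transitivity (mass w * \prod_(x <- es) (present w x)%:R).
    case: ifP => [/allP wes|/negbT/allPn[x xes /negPf nx]].
      by rewrite [X in _ = _ * X]big_seq [X in _ = _ * X]big1 ?mulr1 // => x /wes ->.
    by rewrite [X in _ = _ * X](big_rem x) //= nx mul0r mulr0.
  congr (_ * _); rewrite big_seq [RHS]big_seq; apply: eq_bigr => x xes.
  rewrite -(@edge_prod (present w x)%:R x) ?(allP es2) //.
  by apply: eq_bigr => e /eqP xe; rewrite (presentE w xe).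
rewrite -(bigA_distr_bigA F).
have -> : (p / 2) ^+ size es
    = \prod_(e : vpair 'I_n) \prod_(x <- es | x.1 == val e) (p / 2).
  rewrite (exchange_big_dep predT) //= big_seq.
  rewrite (eq_bigr (fun=> p / 2)) -?big_seq ?big_const_seq ?count_predT.
    by rewrite iter_mulr_1.
  by move=> x xes; rewrite edge_prod // (allP es2).
apply: eq_bigr => e _; rewrite sum_option /F /= -!(big_filter es).
(* The pairs in [es] are distinct, so at most one entry constrains [e]. *)
have : (size [seq x <- es | x.1 == val e] <= 1)%N.
  rewrite size_filter -(count_map fst (pred1 (val e))).
  by rewrite count_uniq_mem ?leq_b1.
case: {F} [seq x <- es | _] => [|x [|//]] _; rewrite ?big_nil ?big_seq1.
  by rewrite !mulr1 -addrA -splitr subrK.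
by case: x.2; rewrite !(mulr0, mulr1, addr0, add0r).
Qed.

Lemma Pr_le (A B : pred graph) : (forall w, A w -> B w) ->
  Pr_Gnp2 p A <= Pr_Gnp2 p B.
Proof.
move=> AB; rewrite /Pr_Gnp2 big_mkcond [leRHS]big_mkcond /=.
apply: ler_sum => w _; case: ifP => [/AB ->//|_].
by case: ifP => // _; apply: mass_ge0.
Qed.

(** If the lists give one pair two colors, the events exclude each other. Otherwise only the edges
    of [es'] outside [es] cost [p / 2]. The sum [p / 2 + (x \in es)%:R] replaces this case
    distinction because it is a weight per edge, to which transfer matrices apply. *)
Lemma Pr_joint_present es es' : edge_list es -> edge_list es' ->
  Pr_Gnp2 p (fun w : graph => all (present w) es && all (present w) es')
  <= (p / 2) ^+ size es * \prod_(x <- es') (p / 2 + (x \in es)%:R).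
Proof.
move=> /andP[es2 ues] /andP[es2' ues'].
have p20 : 0 <= p / 2 by case/andP: p01 => p0 _; rewrite divr_ge0.
have prod0 : 0 <= \prod_(x <- es') (p / 2 + (x \in es)%:R).
  by apply: prodr_ge0 => x _; rewrite addr_ge0.
set new := [seq x <- es' | x \notin es].
have mn x : x \in new -> x \in es' /\ x \notin es by rewrite mem_filter => /andP[].
have [ucat|] := boolP (uniq (unzip1 (es ++ new))).
  rewrite (@le_trans _ _ (Pr_Gnp2 p (fun w : graph => all (present w) (es ++ new)))) //.
    apply: Pr_le => w /andP[wes /allP wes']; rewrite all_cat wes /=.
    by apply/allP => x /mn[/wes'].
  rewrite Pr_all_present; last first.
    rewrite /edge_list ucat andbT all_cat es2 /=.
    by apply/allP => x /mn[/(allP es2')].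
  rewrite size_cat exprD ler_wpM2l ?exprn_ge0 //.
  rewrite -[_ ^+ size new]iter_mulr_1 -(count_predT new) -big_const_seq big_filter.
  rewrite big_mkcond /=.
  apply: ler_prod => x _; case: (x \in es) => /=.
    by rewrite ler01 lerDr.
  by rewrite addr0 p20 lexx.
rewrite /unzip1 map_cat cat_uniq ues /= => nu.
have unew : uniq (map fst new).
  by apply: subseq_uniq ues'; apply: map_subseq; apply: filter_subseq.
move: nu; rewrite unew andbT negbK => /hasP[y /mapP[x xnew ->] /mapP[z zes xz]].
rewrite (@le_trans _ _ 0) ?mulr_ge0 ?exprn_ge0 // /Pr_Gnp2 big_pred0 // => w.
apply/negbTE/negP => /andP[/allP wes /allP wes'].
have [xes' xes] := mn x xnew.
have := wes' x xes'; have := wes z zes; rewrite /present xz.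
move=> /eqP -> /eqP[zx]; case/negP: xes.
by rewrite (_ : x = z) //; case: x z xz zx {xnew zes xes'} => [x1 x2] [z1 z2] /= -> ->.
Qed.

(* For a nonnegative variable [X], [1_{X > 0} >= 2 s X - s^2 X^2]; the choice
   [s = 1 / b] turns a bound [E X^2 <= b E X] into [P(X > 0) >= E X / b]. *)
Lemma second_moment (I : finType) (P : pred I) (es : I -> seq (colored_edge 'I_n))
    (A : pred graph) (b : R) : 0 < b ->
  (forall i, P i -> edge_list (es i)) ->
  (forall i w, P i -> all (present w) (es i) -> A w) ->
  (forall i, P i ->
     \sum_(j | P j) \prod_(x <- es j) (p / 2 + (x \in es i)%:R) <= b) ->
  (\sum_(i | P i) (p / 2) ^+ size (es i)) / b <= Pr_Gnp2 p A.
Proof.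
move=> b0 es_ok esA es_b.
pose on i (w : graph) : R := (all (present w) (es i))%:R.
pose X w := \sum_(i | P i) on i w.
have PrE B : Pr_Gnp2 p B = \sum_w mass w * (B w)%:R.
  rewrite /Pr_Gnp2 big_mkcond; apply: eq_bigr => w _.
  by case: (B w); rewrite ?mulr1 ?mulr0.
set mu := \sum_(i | P i) _.
have EX : \sum_w mass w * X w = mu.
  under eq_bigr do rewrite mulr_sumr; rewrite exchange_big /=.
  by apply: eq_bigr => i Pi; rewrite -Pr_all_present ?es_ok // PrE.
have EX2 : \sum_w mass w * X w ^+ 2 <= mu * b.
  have -> : \sum_w mass w * X w ^+ 2 =
      \sum_(i | P i) \sum_(j | P j) Pr_Gnp2 p (fun w : graph =>
        all (present w) (es i) && all (present w) (es j)).
    under eq_bigr do rewrite expr2 mulr_suml mulr_sumr.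
    rewrite exchange_big /=; apply: eq_bigr => i _.
    under eq_bigr do rewrite mulr_sumr mulr_sumr.
    rewrite exchange_big /=; apply: eq_bigr => j _; rewrite PrE.
    by apply: eq_bigr => w _; rewrite /on -natrM mulnb.
  rewrite mulr_suml; apply: ler_sum => i Pi.
  apply: le_trans (ler_wpM2l _ (es_b i Pi)); last first.
    by rewrite exprn_ge0 // divr_ge0 //; case/andP: p01.
  rewrite mulr_sumr; apply: ler_sum => j Pj.
  by apply: Pr_joint_present; apply: es_ok.
have -> : mu / b = 2 * b^-1 * mu - b^-1 ^+ 2 * (mu * b).
  by rewrite expr2; field; rewrite gt_eqF.
apply: (@le_trans _ _ (2 * b^-1 * mu - b^-1 ^+ 2 * \sum_w mass w * X w ^+ 2)).
  by rewrite lerD2l lerN2 ler_wpM2l // exprn_ge0 // invr_ge0 ltW.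
rewrite -EX !mulr_sumr -sumrB PrE; apply: ler_sum => w _.
have -> : 2 / b * (mass w * X w) - b^-1 ^+ 2 * (mass w * X w ^+ 2)
    = mass w * (1 - (1 - X w / b) ^+ 2) by ring.
rewrite ler_wpM2l ?mass_ge0 //; case: (boolP (A w)) => [_|nA].
  by rewrite gerBl sqr_ge0.
rewrite /X big1 ?mul0r ?subr0 ?expr1n ?subrr // => i Pi.
by rewrite /on; case: (boolP (all _ _)) => // /(esA _ _ Pi); rewrite (negPf nA).
Qed.

End Probability.

(** * Transfer matrices *)

Section Kernel.
Variables (R : realFieldType) (V : finType).
Implicit Types (M : bool -> V -> V -> R) (c : bool) (x y z : V) (k : nat).

(** The total weight of the walks of [k] steps from [x] to [y] with alternating colors, the first
    being [c]: an alternating matrix product. *)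
Fixpoint ker M k c x y : R :=
  if k is k'.+1 then \sum_z M c x z * ker M k' (~~ c) z y else (x == y)%:R.

Definition rowsum M k c x : R := \sum_y ker M k c x y.

Lemma kerS M k c x y :
  ker M k.+1 c x y = \sum_z M c x z * ker M k (~~ c) z y.
Proof. by []. Qed.

Lemma sum_delta x (F : V -> R) : \sum_y (x == y)%:R * F y = F x.
Proof.
rewrite (bigD1 x) //= eqxx mul1r big1 ?addr0 // => y.
by rewrite eq_sym => /negPf ->; rewrite mul0r.
Qed.

Lemma rowsum0 M c x : rowsum M 0 c x = 1.
Proof.
rewrite /rowsum /= -[RHS](sum_delta x (fun=> 1)).
by apply: eq_bigr => y _; rewrite mulr1.
Qed.

Lemma rowsumS M k c x :
  rowsum M k.+1 c x = \sum_z M c x z * rowsum M k (~~ c) z.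
Proof.
rewrite /rowsum /= exchange_big /=; apply: eq_bigr => z _.
by rewrite mulr_sumr.
Qed.

Lemma ker_ge0 M k c x y : (forall c x y, 0 <= M c x y) -> 0 <= ker M k c x y.
Proof.
move=> M0; elim: k c x => [|k IH] c x /=; first exact: ler0n.
by apply: sumr_ge0 => z _; rewrite mulr_ge0.
Qed.

Lemma rowsum_ge0 M k c x : (forall c x y, 0 <= M c x y) -> 0 <= rowsum M k c x.
Proof. by move=> M0; apply: sumr_ge0 => y _; apply: ker_ge0. Qed.

Lemma ker_scale M a k c x y :
  ker (fun c x y => a * M c x y) k c x y = a ^+ k * ker M k c x y.
Proof.
elim: k c x => [|k IH] c x /=; first by rewrite expr0 mul1r.
rewrite mulr_sumr; apply: eq_bigr => z _; rewrite IH exprS; ring.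
Qed.

Lemma ker_rcons M k c x y :
  ker M k.+1 c x y = \sum_z ker M k c x z * M (c (+) odd k) z y.
Proof.
elim: k c x => [|k IH] c x.
  rewrite /= addbF (sum_delta x (fun z => M c z y)).
  rewrite -(sum_delta y (fun z => M c x z)).
  by apply: eq_bigr => z _; rewrite eq_sym mulrC.
rewrite kerS; under eq_bigr do rewrite IH mulr_sumr.
rewrite exchange_big /=; apply: eq_bigr => z _; rewrite mulr_suml.
by apply: eq_bigr => t _; rewrite mulrA addbN addNb.
Qed.

(** Reverse the walks: for positive [k] the last of [k] alternating steps has color
    [c (+) ~~ odd k]. *)
Lemma ker_sym M k c x y : (forall c x y, M c x y = M c y x) ->
  ker M k c x y = ker M k (c (+) ~~ odd k) y x.
Proof.
move=> Msym; elim: k c x y => [|k IH] c x y; first by rewrite /= eq_sym.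
rewrite ker_rcons kerS negbK; apply: eq_bigr => z _.
by rewrite Msym IH mulrC addbN.
Qed.

(* Meant for odd [k]: closed alternating walks of [k + 2] steps. The condition
   [z != z'] is the only trace of injectivity that the overlap bound needs: at
   a vertex of D of degree 2 it prevents both ends of the loop from following
   the same edge of D. *)
Definition loop M k c x : R :=
  \sum_z \sum_(z' | z != z') M c x z * ker M k (~~ c) z z' * M c z' x.

Lemma loop_ge0 M k c x : (forall c x y, 0 <= M c x y) -> 0 <= loop M k c x.
Proof.
move=> M0; apply: sumr_ge0 => z _; apply: sumr_ge0 => z' _.
by rewrite !mulr_ge0 // ker_ge0.
Qed.

Lemma loop_scale M a k c x :
  loop (fun c x y => a * M c x y) k c x = a ^+ k.+2 * loop M k c x.
Proof.
rewrite /loop mulr_sumr; apply: eq_bigr => z _; rewrite mulr_sumr.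
by apply: eq_bigr => z' _; rewrite ker_scale !exprS; ring.
Qed.

End Kernel.
Arguments ker : simpl never.

Section Transfer.
Variables (R : realFieldType) (V : finType) (A : bool -> V -> V -> R).
Notation n := (#|V|%:R : R).
Hypothesis n_gt0 : 0 < n.
Hypothesis A_ge0 : forall c x y, 0 <= A c x y.
Hypothesis A_sym : forall c x y, A c x y = A c y x.
(** [h x] bounds the total weight of the nonempty [A]-walks from [x] of at most [len] steps, and
    [eta] bounds the average of [h]. *)
Variables (len : nat) (h : V -> R) (eta : R).
Hypothesis h_ge0 : forall x, 0 <= h x.
Hypothesis A_rows : forall c x, \sum_(i < len) rowsum A i.+1 c x <= h x.
Hypothesis h_sum : \sum_x h x <= n * eta.

(* Weights are divided by [1 + eps], so that a step to a uniform vertex has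
   total weight 1 and [A] carries the weight [1 / (1 + eps)] on edges of D. *)
Definition perturb c x y : R := n^-1 + A c x y.
Notation M := perturb.
Let Y := (1 + eta) ^+ len.

Let eta_ge0 : 0 <= eta.
Proof. by rewrite -(pmulr_rge0 _ n_gt0); apply: le_trans h_sum; apply: sumr_ge0. Qed.

Let M_ge0 c x y : 0 <= M c x y.
Proof. by rewrite addr_ge0 // invr_ge0 ltW. Qed.

Let M_sym c x y : M c x y = M c y x.
Proof. by rewrite /perturb A_sym. Qed.

Lemma sum_rowsum_le k c x : (k <= len)%N ->
  \sum_(i < k.+1) rowsum A i c x <= 1 + h x.
Proof.
move=> kL; rewrite big_ord_recl rowsum0 lerD2l; apply: le_trans (A_rows c x).
rewrite (big_ord_widen len (fun i => rowsum A i.+1 c x) kL) big_mkcond /=.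
by apply: ler_sum => i _; case: ifP => // _; apply: rowsum_ge0.
Qed.

(** Split a walk at its first uniform step: before it the walk uses [A] only, and after it the walk
    starts from a uniform vertex, where the average [b] applies. Walks without a uniform step are
    covered by [1 <= b]. *)
Lemma rowsum_perturb_avg k c x b : 1 <= b ->
  (forall j c, (j < k)%N -> \sum_z rowsum M j c z <= n * b) ->
  rowsum M k c x <= b * \sum_(i < k.+1) rowsum A i c x.
Proof.
move=> b1; elim: k c x => [|k IH] c x avg.
  by rewrite big_ord_recl big_ord0 addr0 !rowsum0 mulr1.
rewrite rowsumS big_ord_recl rowsum0 mulrDr mulr1.
under eq_bigr do rewrite mulrDl.
rewrite big_split /= -mulr_sumr; apply: lerD.
  by rewrite mulrC ler_pdivrMr // mulrC avg.
under [X in _ <= b * X]eq_bigr do rewrite /bump /= add1n rowsumS.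
rewrite exchange_big mulr_sumr /=; apply: ler_sum => z _.
rewrite -mulr_sumr mulrCA ler_wpM2l // IH // => j c' jk.
by apply: avg; apply: ltnW.
Qed.

(** Strong induction: bounding the shorter walks by [(1 + eta) ^+ k] on average, the split at the
    first uniform step costs one more factor, the average of [1 + h]. *)
Lemma avg_rowsum_perturb k c : (k <= len)%N ->
  \sum_x rowsum M k c x <= n * (1 + eta) ^+ k.
Proof.
elim/ltn_ind: k c => -[|k] IH c kL.
  under eq_bigr do rewrite rowsum0.
  by rewrite sumr_const mulr1.
have b1 : 1 <= (1 + eta) ^+ k by rewrite exprn_ege1 // lerDl.
rewrite exprSr mulrCA [X in _ <= _ * X](_ : _ = \sum_(x : V) 1 + n * eta); last first.
  by rewrite sumr_const mulrDr mulr1.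
apply: (@le_trans _ _ (\sum_x (1 + eta) ^+ k * (1 + h x))).
  apply: ler_sum => x _.
  apply: le_trans (@rowsum_perturb_avg k.+1 c x _ b1 _) _.
    move=> j c' jk; apply: le_trans (IH j jk c' (ltnW (leq_trans jk kL))) _.
    by rewrite ler_wpM2l ?(ltW n_gt0) //; apply: ler_weXn2l;
      rewrite ?lerDl // -ltnS.
  by rewrite ler_wpM2l ?sum_rowsum_le // (le_trans ler01 b1).
rewrite -mulr_sumr ler_wpM2l ?(le_trans ler01) //.
by rewrite big_split /= lerD2l.
Qed.

Let Y1 : 1 <= Y.
Proof. by rewrite exprn_ege1 // lerDl. Qed.

Let Y0 : 0 <= Y.
Proof. exact: le_trans ler01 Y1. Qed.

Lemma rowsum_perturb k c x : (k <= len)%N ->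
  rowsum M k c x <= Y * (1 + h x).
Proof.
move=> kL; apply: le_trans (@rowsum_perturb_avg k c x Y Y1 _) _; last first.
  by rewrite ler_wpM2l ?sum_rowsum_le // Y0.
move=> j c' jk; have jL : (j <= len)%N := ltnW (leq_trans jk kL).
apply: le_trans (avg_rowsum_perturb c' jL) _.
by rewrite ler_wpM2l ?(ltW n_gt0) //; apply: ler_weXn2l;
      rewrite ?lerDl // -ltnS.
Qed.

Lemma colsum_perturb k c y : (k <= len)%N ->
  \sum_x ker M k c x y <= Y * (1 + h y).
Proof.
move=> kL; under eq_bigr do rewrite (ker_sym _ _ _ _ M_sym).
exact: rowsum_perturb.
Qed.

(* Split a walk at its first and last steps of weight [1 / n]. *)
Lemma ker_perturb k c x y : (k <= len)%N ->
  ker M k c x y <= ker A k c x y + Y / n * (1 + h x) * (1 + h y).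
Proof.
move=> kL.
have Yh0 : 0 <= Y * (1 + h y) by rewrite mulr_ge0 ?addr_ge0.
suff bound j c' x' : (j <= len)%N -> ker M j c' x' y <=
    ker A j c' x' y + n^-1 * (Y * (1 + h y)) * \sum_(i < j) rowsum A i c' x'.
  apply: le_trans (bound k c x kL) _; rewrite lerD2l.
  rewrite (_ : Y / n * _ * _ = n^-1 * (Y * (1 + h y)) * (1 + h x)); last by ring.
  rewrite ler_wpM2l //; first by rewrite mulr_ge0 // invr_ge0 ltW.
  apply: le_trans (sum_rowsum_le c x kL); rewrite big_ord_recr /= lerDl.
  exact: rowsum_ge0.
elim: j c' x' => [|j IH] c' x' jL; first by rewrite big_ord0 mulr0 addr0.
rewrite kerS; under eq_bigr do rewrite mulrDl.
rewrite big_split /= -mulr_sumr addrC big_ord_recl rowsum0 mulrDr mulr1.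
rewrite [leRHS]addrCA [leRHS]addrC; apply: lerD; last first.
  by rewrite ler_wpM2l ?invr_ge0 ?(ltW n_gt0) // colsum_perturb // ltnW.
under [X in _ <= _ + _ * X]eq_bigr do rewrite lift0 rowsumS.
rewrite exchange_big mulr_sumr /= -big_split /=; apply: ler_sum => z _.
by rewrite -mulr_sumr mulrCA -mulrDr ler_wpM2l // IH // ltnW.
Qed.

(** Forget [z != z']; oddness of [k] makes the last of the [k + 2] steps have color [c] again. *)
Lemma loop_le_ker k c x : odd k -> loop M k c x <= ker M k.+2 c x x.
Proof.
move=> kodd; rewrite kerS; apply: ler_sum => z _.
rewrite ker_rcons mulr_sumr big_mkcond /=; apply: ler_sum => z' _.
rewrite kodd addNb addbT negbK mulrA; case: ifP => // _.
by rewrite !mulr_ge0 // ker_ge0.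
Qed.

(** The two end steps cannot both use [A], so one of them can be charged [n^-1]. What remains is a
    walk of [k + 1] steps from or to [x], which costs a single factor [1 + h x]. *)
Lemma loop_perturb_nobranch k c x : odd k -> (k < len)%N ->
  (forall z z', z != z' -> A c x z * A c x z' = 0) ->
  loop M k c x <= 2 * (Y / n) * (1 + h x).
Proof.
move=> kodd kL nobr.
have -> : 2 * (Y / n) * (1 + h x)
  = n^-1 * (Y * (1 + h x)) + n^-1 * (Y * (1 + h x)) by ring.
apply: (@le_trans _ _ (n^-1 * \sum_z ker M k.+1 (~~ c) z x
                       + n^-1 * rowsum M k.+1 c x)); last first.
  apply: lerD; rewrite ler_wpM2l ?invr_ge0 ?(ltW n_gt0) //.
    exact: colsum_perturb.
  exact: rowsum_perturb.
rewrite rowsumS !mulr_sumr -big_split /=; apply: ler_sum => z _.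
rewrite ker_rcons /rowsum !mulr_sumr -big_split /= big_mkcond /=.
apply: ler_sum => z' _; rewrite kodd addNb addbT negbK.
have K0 : 0 <= ker M k (~~ c) z z' by apply: ker_ge0.
case: ifP => [zz'|_]; last first.
  by rewrite addr_ge0 // !mulr_ge0 ?invr_ge0 ?(ltW n_gt0).
rewrite (_ : n^-1 * _ + _ = ker M k (~~ c) z z' * (n^-1 * M c z' x + M c x z * n^-1)); last by ring.
rewrite mulrAC mulrC ler_wpM2l // /perturb (A_sym c z').
have := nobr z z' zz'; nra.
Qed.

End Transfer.

(** * Alternating walks inside a dumbbell *)

Section Phase.
Local Open Scope nat_scope.
Variables a b N : nat.
Hypotheses (a_gt0 : 0 < a) (ab : a < b) (bN : b.+1 < N).
Hypotheses (a_even : ~~ odd a) (b_odd : odd b) (N_even : ~~ odd N).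

(* The vertices of a dumbbell are numbered 0, ..., N - 1 along a spanning path,
   the junctions being [a] and [b]; the edge {i, i + 1} has color [odd i] and
   the closing edges {0, a} and {b, N - 1} are red. *)
Definition dadj (c : bool) (i j : nat) : bool :=
  [|| (j == i.+1) && (odd i == c), (i == j.+1) && (odd j == c)
    | c && [|| (i == 0) && (j == a), (i == a) && (j == 0),
               (i == b) && (j == N.-1) | (i == N.-1) && (j == b)]].

(** The length of the closed tour that goes around each loop once and through the connecting path
    once in each direction. *)
Definition period : nat := a.+1 + (b - a) + (N - b) + (b - a).

(* An alternating walk about to leave [i] by color [c] moves up if [odd i == c]
   and down otherwise. Both ways around a loop take the same time, so the number
   of steps before the walk has to choose a direction around the loop at [a] is
   determined by [(c, i)] and drops by one, modulo [period], at each step. *)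
Definition phase (c : bool) (i : nat) : nat :=
  if odd i == c then
    if i <= b then (b - i) + (N - b) + (b - a) else (N - i) + (b - a)
  else if a <= i then i - a else i.+1 + (b - a) + (N - b) + (b - a).

(** Phase 0 is arrival at [a] with the left loop ahead, and phase [(N - b) + (b - a)] is arrival at
    [b] with the right loop ahead; this is the time to the earlier of the two. *)
Definition branch_time (c : bool) (i : nat) : nat :=
  if phase c i < (N - b) + (b - a) then phase c i
  else phase c i - ((N - b) + (b - a)).

(** Between two consecutive choices a walk completes one loop and crosses the connecting path. *)
Definition branch_gap : nat := minn a.+1 (N - b) + (b - a).

Lemma phase_dadj c i j : i < N -> j < N -> dadj c i j ->
  (phase (~~ c) j).+1 = phase c i \/
  phase c i = 0 /\ (phase (~~ c) j).+1 = period.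
Proof.
by rewrite /phase /period /dadj; case: c => /=; rewrite ?eqb_id ?eqbF_neg; do ?[case: ifP => ?]; lia. Qed.

Lemma branch_time_dadj c i j : i < N -> j < N -> dadj c i j ->
  (branch_time (~~ c) j).+1 = branch_time c i \/
  branch_time c i = 0 /\ branch_gap <= (branch_time (~~ c) j).+1.
Proof.
move=> iN jN ij; have := phase_dadj iN jN ij.
rewrite /branch_time /branch_gap /period.
do ?[case: ifP => ?]; lia.
Qed.

Lemma branch_time_eq0 c i : i < N ->
  (branch_time c i == 0) = c && ((i == a) || (i == b)).
Proof.
move=> iN.
have -> : (branch_time c i == 0) =
    (phase c i == 0) || (phase c i == (N - b) + (b - a)).
  by rewrite /branch_time; case: ifP => ?; lia.
rewrite /phase; case: c => /=; rewrite ?eqb_id ?eqbF_neg.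
  by do ?[case: ifP => ?]; lia.
by do ?[case: ifP => ?]; lia.
Qed.

(** Colors alternate along the numbering and the closing edges are red, so only red steps at the two
    junctions are ambiguous. *)
Lemma dadj_unique c i j j' : i < N -> j < N -> j' < N -> branch_time c i != 0 ->
  dadj c i j -> dadj c i j' -> j = j'.
Proof.
move=> iN jN jN'; rewrite branch_time_eq0 // /dadj.
by case: c => /=; rewrite ?eqb_id ?eqbF_neg; lia.
Qed.

Lemma dadj_branch c i j : i < N -> j < N -> branch_time c i = 0 -> dadj c i j ->
  j = (if i == a then 0 else N.-1) \/ j = (if i == a then a.-1 else b.+1).
Proof.
move=> iN jN /eqP; rewrite branch_time_eq0 // /dadj.
by case: c => //=; rewrite ?eqb_id ?eqbF_neg; case: ifP => ?; lia.
Qed.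

End Phase.

Lemma sum_nbrs_le (R : realFieldType) (V : finType) (P : pred V) (F : V -> R)
    (b : R) (s : seq V) : 0 <= b ->
  (forall z, P z -> z \in s) -> (forall z, P z -> F z <= b) ->
  \sum_z (P z)%:R * F z <= b * (size s)%:R.
Proof.
move=> b0 Ps Fb; apply: (@le_trans _ _ (\sum_(z in s) b)).
  rewrite [leRHS]big_mkcond /=; apply: ler_sum => z _.
  case: (boolP (P z)) => [Pz|_]; first by rewrite mul1r Ps ?Fb.
  by rewrite mul0r; case: ifP.
by rewrite sumr_const -[b *+ _]mulr_natr ler_wpM2l // ler_nat card_size.
Qed.

Lemma sum_unique_support_le (R : realFieldType) (I : finType) (F : I -> R) (b : R) :
  0 <= b -> (forall i, F i <= b) ->
  (forall i j, F i != 0 -> F j != 0 -> i = j) -> \sum_i F i <= b.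
Proof.
move=> b0 Fb uF; have [|nz] := pickP (fun i => F i != 0) => [i Fi|]; last first.
  by rewrite big1 // => i _; apply/eqP; rewrite -[_ == _]negbK nz.
rewrite (bigD1 i) //= big1 ?addr0 // => j ji.
by apply: contraNeq ji => Fj; rewrite (uF i j).
Qed.

(** * Counting walks inside a dumbbell by their phase *)

Section PhasedWalks.
Variables (R : realFieldType) (V : finType) (B : bool -> V -> V -> bool).
Variables (a b N : nat) (S : seq V).
Hypotheses (a_gt0 : (0 < a)%N) (ab : (a < b)%N) (bN : (b.+1 < N)%N).
Hypotheses (a_even : ~~ odd a) (b_odd : odd b) (N_even : ~~ odd N).
Hypotheses (S_uniq : uniq S) (S_size : size S = N).
Hypothesis B_adj : forall c x y, B c x y ->
  [/\ x \in S, y \in S & dadj a b N c (index x S) (index y S)].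

Definition step01 (c : bool) (x y : V) : R := (B c x y)%:R.

Lemma step01_ge0 c x y : 0 <= step01 c x y.
Proof. exact: ler0n. Qed.

Lemma rowsum_outside k c x : x \notin S -> rowsum step01 k.+1 c x = 0.
Proof.
move=> xS; rewrite rowsumS big1 // => z _; rewrite /step01.
case: (boolP (B c x z)) => [/B_adj[xS' _ _]|_]; last by rewrite mul0r.
by rewrite xS' in xS.
Qed.

Let pos x := index x S.
Let pos_lt x : x \in S -> (pos x < N)%N.
Proof. by rewrite -S_size index_mem. Qed.

(** A walk is forced until its first branch; there it has two continuations, each forced for the
    rest of the gap. The two bounds are proved together because the second, at a branch, uses the
    first at the next vertex. *)
Lemma rowsum_branch_time k c x : x \in S ->
  ((k <= branch_time a b N c (pos x))%N -> rowsum step01 k c x <= 1) /\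
  ((k <= branch_time a b N c (pos x) + branch_gap a b N)%N ->
     rowsum step01 k c x <= 2).
Proof.
have [x0 _|V0] := pickP (fun _ : V => true); last by have := V0 x.
elim: k c x => [|k IH] c x xS; first by rewrite rowsum0; split=> _ //; lra.
rewrite rowsumS.
have step z : B c x z -> [/\ z \in S, (pos z < N)%N,
    dadj a b N c (pos x) (pos z) & nth x0 S (pos z) = z].
  by case/B_adj => _ zS xz; split; rewrite ?pos_lt ?nth_index.
have xN := pos_lt xS.
have := @branch_time_dadj a b N a_gt0 ab bN a_even b_odd N_even c (pos x).
have := @dadj_unique a b N a_gt0 ab bN a_even b_odd N_even c (pos x).
have := @dadj_branch a b N a_gt0 ab bN a_even b_odd N_even c (pos x).
case: (branch_time a b N c (pos x)) => [|t] two one next.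
  split=> [//|]; rewrite add0n => kg; rewrite -[leRHS]mul1r.
  pose s := [:: nth x0 S (if pos x == a then 0 else N.-1);
                nth x0 S (if pos x == a then a.-1 else b.+1)]%N.
  apply: (@sum_nbrs_le _ _ _ _ 1 s) => // z /step[zS zN xz zz].
    by rewrite /s !inE; case: (two _ xN zN erefl xz) => <-; rewrite zz eqxx ?orbT.
  by case: (next _ xN zN xz) => [//|[_ gz]]; apply: (IH _ _ zS).1; lia.
pose s := [seq z <- S | B c x z].
have s1 : (size s <= 1)%N.
  have : uniq s by rewrite filter_uniq.
  have : {in s &, forall z z', z = z'}.
    move=> z z'; rewrite !mem_filter => /andP[/step[_ zN xz zz] _].
    move=> /andP[/step[_ zN' xz' zz'] _].
    by rewrite -zz -zz' (one _ _ xN zN zN' isT xz xz').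
  case: (s) => [|z [|z' s']] // zz /andP[]; rewrite inE.
  by rewrite (zz z z') ?inE ?eqxx ?orbT.
have ub d : 0 <= d -> (forall z, B c x z -> rowsum step01 k (~~ c) z <= d) ->
    \sum_z step01 c x z * rowsum step01 k (~~ c) z <= d.
  move=> d0 zd; apply: (@le_trans _ _ (d * (size s)%:R)).
    apply: sum_nbrs_le => // z xz; rewrite mem_filter xz.
    by case: (step z xz).
  by rewrite -[leRHS]mulr1 ler_wpM2l // -[1]/(1%:R) ler_nat.
split=> kt; apply: ub => // z /step[zS zN xz _];
  case: (next _ xN zN xz) => [[ez]|[//]].
  by apply: (IH _ _ zS).1; lia.
by apply: (IH _ _ zS).2; lia.
Qed.

Lemma rowsum_step01 k c x : (k.+1 <= branch_gap a b N)%N ->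
  rowsum step01 k.+1 c x <= 2 * (x \in S)%:R.
Proof.
move=> kg; case: (boolP (x \in S)) => xS; last by rewrite rowsum_outside ?mulr0.
by rewrite mulr1; apply: (rowsum_branch_time _ _ xS).2; lia.
Qed.

Lemma ker_step01_phase k c x y : x \in S -> ker step01 k c x y != 0 ->
  y \in S /\ phase a b N (c (+) odd k) (pos y) + k
             = phase a b N c (pos x) %[mod period a b N].
Proof.
elim: k c x => [|k IH] c x xS.
  rewrite /ker pnatr_eq0 eqb0 negbK => /eqP <-; split=> //.
  by rewrite addbF addn0.
rewrite kerS => nz.
have [z] : exists z, step01 c x z * ker step01 k (~~ c) z y != 0.
  apply/existsP; apply: contraNT nz; rewrite negb_exists => /forallP z0.
  by rewrite big1 // => z _; apply/eqP; rewrite -[_ == _]negbK.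
rewrite mulf_eq0 negb_or pnatr_eq0 eqb0 negbK => /andP[/B_adj[_ zS xz] kz].
have [yS e] := IH _ _ zS kz; split=> //.
have := @phase_dadj a b N a_gt0 ab bN a_even b_odd N_even _ _ _
  (pos_lt xS) (pos_lt zS) xz.
rewrite /= addbN -addNb addnS.
move/eqP: e; rewrite -(eqn_modDr 1) !addn1 => /eqP ->.
by case=> [->//|[-> ->]]; rewrite modnn mod0n.
Qed.

(** All lengths are odd, so the final color and vertex, hence the final phase, do not depend on the
    length. The phases then fix the length modulo [period]. Since all lengths are below [period],
    only one term is nonzero, and it is at most 2. *)
Lemma sum_ker_step01 (T : nat) c x y : (4 * T <= (branch_gap a b N).+1)%N ->
  \sum_(i < T) ker step01 (2 * (T + i)).+1 c x y
  <= 2 * (x \in S)%:R * (y \in S)%:R.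
Proof.
move=> Tg.
have [xS|xS] := boolP (x \in S); last first.
  rewrite mulr0 mul0r sumr_le0 // => i _; rewrite -(rowsum_outside (2 * (T + i)) c xS).
  rewrite /rowsum (bigD1 y) //= lerDl; apply: sumr_ge0 => z _.
  exact/ker_ge0/step01_ge0.
have [yS|yS] := boolP (y \in S); last first.
  rewrite mulr0 sumr_le0 // => i _.
  have [-> //|nz] := eqVneq (ker step01 (2 * (T + i)).+1 c x y) 0.
  by have [yS' _] := ker_step01_phase xS nz; rewrite yS' in yS.
rewrite !mulr1; apply: sum_unique_support_le => // [i|i j nzi nzj].
  apply: (@le_trans _ _ (rowsum step01 (2 * (T + i)).+1 c x)).
    rewrite /rowsum (bigD1 y) //= lerDl; apply: sumr_ge0 => z _.
    exact/ker_ge0/step01_ge0.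
  apply: le_trans (rowsum_step01 _ _ _) _; last by rewrite xS mulr1.
  by have := ltn_ord i; lia.
have [_] := ker_step01_phase xS nzi; have [_] := ker_step01_phase xS nzj.
rewrite /= !mul2n !odd_double => <- /eqP; rewrite eqn_modDl => /eqP.
have short (t : 'I_T) : ((T + t).*2.+1 < period a b N)%N.
  by have := ltn_ord t; rewrite /period /branch_gap in Tg *; lia.
rewrite !modn_small // => e; apply: val_inj => /=; lia.
Qed.

Lemma step01_branch x y z : step01 true x y * step01 true x z != 0 ->
  y != z -> pos x = a \/ pos x = b.
Proof.
rewrite mulf_eq0 !pnatr_eq0 !eqb0 negb_or !negbK => /andP[].
move=> /B_adj[xS yS xy] /B_adj[_ zS xz] yz.
have := @dadj_unique a b N a_gt0 ab bN a_even b_odd N_even true (pos x) (pos y) (pos z).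
have := @branch_time_eq0 a b N a_gt0 ab bN a_even b_odd N_even true (pos x).
move=> /(_ (pos_lt xS)) -> /(_ (pos_lt xS) (pos_lt yS) (pos_lt zS)).
case: eqP => [|_]; first by left.
case: eqP => [|_ /(_ isT xy xz)]; first by right.
by move/(congr1 (nth y S)); rewrite /pos !nth_index // => e; rewrite e eqxx in yz.
Qed.

End PhasedWalks.

(** * Dumbbells *)

Section AlternatingPaths.
Variables (V : finType) (R : realFieldType).
Implicit Types (c : bool) (x y z u w : V) (s l : seq V).

Fixpoint alt_path c x s : seq (colored_edge V) :=
  if s is y :: s' then ([set x; y]%SET, c) :: alt_path (~~ c) y s' else [::].

(** [l1] and [l2] list the vertices of the loops other than [u] and [w], and [st] the inner vertices
    of the connecting path. *)
Definition dumbbell u w l1 st l2 : seq (colored_edge V) :=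
  alt_path true u (rcons l1 u) ++ alt_path false u (rcons st w)
  ++ alt_path true w (rcons l2 w).

Lemma size_alt_path c x s : size (alt_path c x s) = size s.
Proof. by elim: s c x => //= y s IH c x; rewrite IH. Qed.

Lemma alt_path_cat c x s1 s2 : alt_path c x (s1 ++ s2) =
  alt_path c x s1 ++ alt_path (c (+) odd (size s1)) (last x s1) s2.
Proof.
elim: s1 c x => [|y s1 IH] c x /=; first by rewrite addbF.
by rewrite IH addNb addbN.
Qed.

Lemma alt_path_rcons c x s y : alt_path c x (rcons s y) =
  rcons (alt_path c x s) ([set last x s; y]%SET, c (+) odd (size s)).
Proof. by rewrite -cats1 alt_path_cat cats1. Qed.

Lemma alt_path_nth x0 c x s : alt_path c x s =
  mkseq (fun i => ([set nth x0 (x :: s) i; nth x0 (x :: s) i.+1]%SET, c (+) odd i))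
        (size s).
Proof.
elim: s c x => // y s IH c x; rewrite /mkseq /= addbF; congr cons.
rewrite -[1%N]addn0 iotaDl -map_comp IH.
by apply: eq_map => i /=; rewrite addNb addbN.
Qed.

Lemma big_tuple_cons k (F : seq V -> R) :
  \sum_(s : k.+1.-tuple V) F s = \sum_z \sum_(s : k.-tuple V) F (z :: s).
Proof.
rewrite pair_bigA /=.
rewrite (reindex (fun t : V * k.-tuple V => [tuple of t.1 :: t.2])) //=.
exists (fun s : k.+1.-tuple V => (thead s, [tuple of behead s])) => [[z s]|s] _ /=.
  by congr pair; apply: val_inj.
by rewrite [RHS]tuple_eta.
Qed.

(** Expansion of the matrix product over vertex sequences; [F] leaves room for one more step at the
    end. *)
Lemma sum_alt_path (W : colored_edge V -> R) k c x (F : V -> R) :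
  \sum_(s : k.-tuple V) (\prod_(e <- alt_path c x s) W e) * F (last x s)
  = \sum_y ker (fun c x y => W ([set x; y]%SET, c)) k c x y * F y.
Proof.
elim: k c x => [|k IH] c x.
  rewrite /ker (sum_delta x F) (big_pred1 [tuple]) => [|s]; last by apply/esym/eqP; exact: tuple0.
  by rewrite big_nil mul1r.
rewrite (big_tuple_cons _ (fun s => (\prod_(e <- alt_path c x s) W e) * F (last x s))).
under [RHS]eq_bigr do rewrite kerS mulr_suml.
rewrite [RHS]exchange_big /=; apply: eq_bigr => z _.
under eq_bigr do rewrite big_cons -mulrA.
rewrite -mulr_sumr IH mulr_sumr; apply: eq_bigr => y _; ring.
Qed.

Lemma sum_alt_walk (W : colored_edge V -> R) k c x y :
  \sum_(s : k.-tuple V) \prod_(e <- alt_path c x (rcons s y)) W e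
  = ker (fun c x y => W ([set x; y]%SET, c)) k.+1 c x y.
Proof.
rewrite ker_rcons -(sum_alt_path W k c x (fun z => W ([set z; y]%SET, c (+) odd k))).
by apply: eq_bigr => s _; rewrite alt_path_rcons big_rcons /= size_tuple mulrC.
Qed.

Lemma sum_alt_loop (W : colored_edge V -> R) k c x :
  (0 < k)%N -> ~~ odd k -> (forall e, 0 <= W e) ->
  \sum_(s : k.-tuple V | uniq s) \prod_(e <- alt_path c x (rcons s x)) W e
  <= loop (fun c x y => W ([set x; y]%SET, c)) k.-1 c x.
Proof.
case: k => // k _; rewrite /= negbK => kodd W0.
rewrite big_mkcond /= (big_tuple_cons _ (fun s => if uniq s then
  \prod_(e <- alt_path c x (rcons s x)) W e else 0)).
apply: ler_sum => z _.
under [leRHS]eq_bigr do rewrite -mulrA.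
rewrite -mulr_sumr [X in _ <= _ * X]big_mkcond /=.
rewrite (eq_bigr (fun z' => ker (fun c x y => W ([set x; y]%SET, c)) k (~~ c) z z' *
   (if z != z' then W ([set z'; x]%SET, c) else 0))); last first.
  by move=> z' _; case: ifP => _ //; rewrite mulr0.
rewrite -(sum_alt_path W k (~~ c) z (fun z' => if z != z' then W ([set z'; x]%SET, c) else 0)).
rewrite mulr_sumr; apply: ler_sum => s _.
have prod0 r : 0 <= \prod_(e <- r) W e by apply: prodr_ge0.
case: ifP => [|_]; last by rewrite !mulr_ge0 //; case: ifP.
move=> /andP[zs _]; rewrite big_cons alt_path_rcons big_rcons /=.
rewrite size_tuple kodd addNb addbT negbK ifT //.
(* [k] is odd, so [s] is nonempty; its last vertex lies in [s] and hence differs from [z]. *)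
apply: contraNneq zs => ->; case: (tval s) (size_tuple s) => [|t r _ /=].
  by move=> k0; rewrite -k0 in kodd.
exact: mem_last.
Qed.

End AlternatingPaths.

Lemma set2_eq (V : finType) (x y z t : V) : [set x; y]%SET = [set z; t]%SET ->
  x = z /\ y = t \/ x = t /\ y = z.
Proof.
move=> /setP e; move: (e x) (e y) (e z) (e t); rewrite !inE !eqxx ?orbT /=.
rewrite ![z == _]eq_sym ![t == _]eq_sym.
case: (x =P z) => ?; case: (x =P t) => ?; case: (y =P z) => ?;
  by case: (y =P t) => ? //=; auto.
Qed.

(** * The numbering of a dumbbell along its spanning path *)

Section Dumbbell.
Variables (V : finType) (u w : V) (l1 st l2 : seq V).

Definition snake : seq V := l1 ++ u :: st ++ w :: l2.
Definition junction : nat := (size l1 + size st).+1.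

Hypotheses (snake_uniq : uniq snake).
Hypotheses (l1_gt0 : (0 < size l1)%N) (l2_gt0 : (0 < size l2)%N).
Hypotheses (l1_even : ~~ odd (size l1)) (st_even : ~~ odd (size st)).
Hypothesis (l2_even : ~~ odd (size l2)).

Notation N := (size snake).
Notation xi := (nth u snake).

Lemma size_snake : N = (size l1 + size st + size l2).+2.
Proof. by rewrite /snake size_cat /= size_cat /= !addnS !addnA. Qed.

Lemma snake_left : xi (size l1) = u.
Proof. by rewrite nth_cat ltnn subnn. Qed.

Lemma snake_right : xi junction = w.
Proof.
by rewrite /junction -addnS nth_cat ltnNge leq_addr /= addKn /= nth_cat ltnn subnn.
Qed.

Lemma dumbbell_nth : dumbbell u w l1 st l2 =
  ([set xi (size l1); xi 0]%SET, true)
  :: mkseq (fun i => ([set xi i; xi i.+1]%SET, odd i)) N.-1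
  ++ [:: ([set xi N.-1; xi junction]%SET, true)].
Proof.
rewrite snake_left snake_right nth_last.
have : (size l1 > 0)%N by []. 
case E: l1 => [//|x0 l1'] _.
(* Without the two closing edges the dumbbell is a single alternating path that starts blue: the
   even sizes of [l1] and [st] make the colors match at [u] and [w]. *)
have -> : mkseq (fun i => ([set xi i; xi i.+1]%SET, odd i)) N.-1
    = alt_path false x0 (rcons l1' u ++ rcons st w ++ l2).
  rewrite (alt_path_nth u) /snake E !cat_rcons /=.
  by apply: eq_map => i.
rewrite /dumbbell /snake E /= !alt_path_cat !last_rcons !last_cat /= !last_cat /=.
rewrite !size_rcons (alt_path_rcons true w l2 w) /= (negPf l2_even) (negPf st_even) /=.
move: l1_even; rewrite E /= negbK => ->.
by rewrite -[rcons (alt_path true w l2) _]cats1 -!catA.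
Qed.

Lemma junction_lt : (junction.+1 < N)%N.
Proof.
by rewrite size_snake /junction !ltnS -[X in (X < _)%N]addn0 ltn_add2l.
Qed.

Lemma left_lt_junction : (size l1 < junction)%N.
Proof. by rewrite /junction ltnS leq_addr. Qed.

Lemma odd_junction : odd junction.
Proof. by rewrite /junction /= oddD (negPf l1_even). Qed.

Lemma even_snake : ~~ odd N.
Proof. by rewrite size_snake /= !oddD (negPf l1_even) (negPf l2_even) (negPf st_even). Qed.

Lemma mem_dumbbell e : e \in dumbbell u w l1 st l2 -> exists i j,
  [/\ (i < N)%N, (j < N)%N, i != j, e.1 = [set xi i; xi j]%SET &
      dadj (size l1) junction N e.2 i j && dadj (size l1) junction N e.2 j i].
Proof.
have := junction_lt; have := left_lt_junction => ab bN.
rewrite dumbbell_nth inE mem_cat inE => /or3P[/eqP ->|/mapP[i]|/eqP ->].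
- by exists (size l1), 0%N; rewrite /dadj /=; split=> //; move: l1_gt0; lia.
- rewrite mem_iota add0n leq0n /= => iN ->.
  by exists i, i.+1; rewrite /dadj /=; split=> //; rewrite ?eqxx ?orbT //; lia.
- by exists N.-1, junction; rewrite /dadj /=; split=> //; lia.
Qed.

Lemma dumbbell_dadj c x y : ([set x; y]%SET, c) \in dumbbell u w l1 st l2 ->
  [/\ x \in snake, y \in snake &
      dadj (size l1) junction N c (index x snake) (index y snake)].
Proof.
move=> /mem_dumbbell[i [j [iN jN _ /= e /andP[ij ji]]]].
by case: (set2_eq e) => -[-> ->]; rewrite !mem_nth // !index_uniq.
Qed.

(** The vertices being distinct, pairs can be compared by positions. [l1] and [l2] are nonempty of
    even size, so each loop has at least two vertices besides its junction and its closing edge is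
    not an edge of the spanning path. *)
Lemma dumbbell_edge_list : edge_list (dumbbell u w l1 st l2).
Proof.
have ab := left_lt_junction; have bN := junction_lt.
have inj i j : (i < N)%N -> (j < N)%N -> xi i = xi j -> i = j.
  by move=> iN jN /eqP; rewrite nth_uniq // => /eqP.
have inj2 i j i' j' : (i < N)%N -> (j < N)%N -> (i' < N)%N -> (j' < N)%N ->
    [set xi i; xi j]%SET = [set xi i'; xi j']%SET -> i = i' /\ j = j' \/ i = j' /\ j = i'.
  by move=> iN jN iN' jN' /set2_eq[][e e']; [left|right]; split; apply: inj.
rewrite /edge_list; apply/andP; split.
  apply/allP => e /mem_dumbbell[i [j [iN jN ij -> _]]].
  by rewrite cards2 nth_uniq // ij.
rewrite dumbbell_nth /unzip1 /= map_cat cat_uniq mem_cat -map_comp /= orbF andbT !inE.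
apply/and3P; split.
- rewrite negb_or; apply/andP; split.
    apply/mapP => -[i]; rewrite mem_iota /= => iN /inj2; move: l1_even l1_gt0; lia.
  apply/eqP => /inj2; move: l1_gt0; lia.
- rewrite map_inj_in_uniq ?iota_uniq // => i j; rewrite !mem_iota /= => iN jN /inj2; lia.
- apply/mapP => -[i]; rewrite mem_iota /= => iN /inj2; move: l2_even l2_gt0.
  have := size_snake; rewrite /junction; lia.
Qed.

End Dumbbell.

Lemma alt_path_adapted (V : finType) (w : edge_colored_graph V)
    (sigma : {ffun V -> color}) c x s : adapted w sigma ->
  all (present w) (alt_path c x s) -> sigma x = c ->
  sigma (last x s) = c (+) odd (size s).
Proof.
move=> /forallP ad; elim: s c x => [|y s IH] c x /=; first by rewrite addbF.
move=> /andP[/eqP xy ws] sx; rewrite addbN -addNb; apply: IH ws _.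
move: (ad x) => /forallP/(_ y); rewrite /edge_color xy sx eqxx /=.
by case: (sigma y) (c) => [] [].
Qed.

(** If [x] is red, the first loop returns to [x] with blue, a contradiction. If [x] is blue, the
    connecting path forces [y] to be red, and the second loop gives the same contradiction. *)
Lemma dumbbell_not_adaptable (V : finType) (w : edge_colored_graph V) x y l1 st l2 :
  ~~ odd (size l1) -> ~~ odd (size st) -> ~~ odd (size l2) ->
  all (present w) (dumbbell x y l1 st l2) -> ~~ adaptably_2colorable w.
Proof.
move=> l1e ste l2e; rewrite !all_cat => /and3P[w1 w2 w3].
apply/existsP => -[sigma ad].
have := alt_path_adapted ad w1; have := alt_path_adapted ad w2.
have := alt_path_adapted ad w3; rewrite !last_rcons !size_rcons /= l1e ste l2e.
by case: (sigma x) (sigma y) => [] [] A B C;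
  first [by have := A erefl | by have := B erefl | by have := C erefl].
Qed.

(** * Dumbbells overlapping a fixed dumbbell *)

Lemma sum_geometric_le (R : realFieldType) (eps : R) k : 0 < eps ->
  \sum_(i < k) (1 + eps)^-1 ^+ i.+1 <= eps^-1.
Proof.
move=> e0; have g0 : 0 < 1 + eps by rewrite addr_gt0.
suff -> : \sum_(i < k) (1 + eps)^-1 ^+ i.+1 = eps^-1 * (1 - (1 + eps)^-1 ^+ k).
  by rewrite ger_pMr ?invr_gt0 // gerBl exprn_ge0 // invr_ge0 ltW.
elim: k => [|k IH]; first by rewrite big_ord0 expr0 subrr mulr0.
rewrite big_ord_recr /= IH exprS.
by set X := _ ^+ k; field; rewrite ?gt_eqF.
Qed.

Lemma sum_mem_le (R : realFieldType) (V : finType) (s : seq V) (b : R) (k : nat) :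
  0 <= b -> (size s <= k)%N -> \sum_x (x \in s)%:R * b <= k%:R * b.
Proof.
move=> b0 sk; rewrite -mulr_suml ler_wpM2r // -natr_sum ler_nat.
rewrite (eq_bigr (fun x => if x \in s then 1%N else 0%N)) => [|x _]; last by case: ifP.
by rewrite -big_mkcond sum1_card; apply: leq_trans (card_size s) sk.
Qed.

Section LegLength.
Variables (T : nat) (i : 'I_T).

Lemma leg_even : ~~ odd (2 * (T + i)).
Proof. by rewrite mul2n odd_double. Qed.

Lemma leg_gt0 : (0 < 2 * (T + i))%N.
Proof. by have := ltn_ord i; lia. Qed.

Lemma leg_lt : ((2 * (T + i)).+1 < 4 * T)%N.
Proof. by have := ltn_ord i; lia. Qed.

Lemma leg_predK : (2 * (T + i)).-1.+1 = (2 * (T + i))%N.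
Proof. by rewrite prednK ?leg_gt0. Qed.

Lemma leg_pred_odd : odd (2 * (T + i)).-1.
Proof. by rewrite -[odd _]negbK -oddS leg_predK leg_even. Qed.

Lemma leg_pred_lt : ((2 * (T + i)).-1 < 4 * T)%N.
Proof. by have := ltn_ord i; lia. Qed.

End LegLength.

Lemma three_legs_le (T : nat) (i j k : 'I_T) :
  ((2 * (T + i) + 2 * (T + j) + 2 * (T + k)).+2 <= 12 * T)%N.
Proof. by have := (ltn_ord i, ltn_ord j, ltn_ord k) => -[[]]; lia. Qed.

Lemma dumbbell_gap_le (T l m r : nat) :
  (4 * T <= minn (2 * (T + l)).+1
      ((2 * (T + l) + 2 * (T + m) + 2 * (T + r)).+2 -
         (2 * (T + l) + 2 * (T + m)).+1)
    + ((2 * (T + l) + 2 * (T + m)).+1 - 2 * (T + l)))%N.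
Proof. by lia. Qed.

Section OverlapBound.
Variables (R : realFieldType) (V : finType) (T : nat) (eps : R).
Notation n := (#|V|%:R : R).
Hypotheses (n_gt0 : 0 < n) (eps_gt0 : 0 < eps).
Variables (i0 j0 k0 : 'I_T) (u0 w0 : V).
Variables (l1 : (2 * (T + i0)).-tuple V) (st : (2 * (T + j0)).-tuple V).
Variable (l2 : (2 * (T + k0)).-tuple V).
Hypothesis S_uniq : uniq (snake u0 w0 l1 st l2).

Notation S := (snake u0 w0 l1 st l2).
Notation D := (dumbbell u0 w0 l1 st l2).
Notation g := (1 + eps).

(* [reach] bounds the total weight of the walks inside D from a vertex of D, and
   [spread] the effect of the returns to D at the endpoints of the other steps.
   [volume] is the sum of [(1 + eps) ^ len] over the lengths of one leg, so the
   expected number of dumbbells is about [volume ^ 3 / n]. *)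
Definition reach : R := 2 / eps.
Definition spread : R := (1 + 12 * T%:R * reach / n) ^+ (4 * T).
Definition volume : R := \sum_(i < T) g ^+ (2 * (T + i)).+1.

Notation H := reach.
Notation Y := spread.
Notation G := volume.

Let in_D c (x y : V) : bool := ([set x; y]%SET, c) \in D.
Let A c (x y : V) : R := g^-1 * step01 R in_D c x y.
Let h (x : V) : R := H * (x \in S)%:R.
Let M := perturb A.

Let g_gt0 : 0 < g. Proof. by rewrite addr_gt0. Qed.
Let H_ge0 : 0 <= H. Proof. by rewrite divr_ge0 // ltW. Qed.
Let H1_ge0 : 0 <= 1 + H. Proof. exact: addr_ge0. Qed.
Let Y_gt0 : 0 < Y.
Proof.
rewrite exprn_gt0 // ltr_pwDl // !mulr_ge0 // invr_ge0; exact: ltW.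
Qed.
Let G_ge0 : 0 <= G.
Proof. by apply: sumr_ge0 => i _; rewrite exprn_ge0 // ltW. Qed.

Let A_ge0 c x y : 0 <= A c x y.
Proof. by rewrite mulr_ge0 // ?invr_ge0 ?(ltW g_gt0) // ler0n. Qed.

Let A_sym c x y : A c x y = A c y x.
Proof. by rewrite /A /step01 /in_D finset.setUC. Qed.

Let M_ge0 c x y : 0 <= M c x y.
Proof. by rewrite addr_ge0 // invr_ge0 ltW. Qed.

Let l1_gt0 : (0 < size l1)%N. Proof. by rewrite size_tuple leg_gt0. Qed.
Let l2_gt0 : (0 < size l2)%N. Proof. by rewrite size_tuple leg_gt0. Qed.
Let l1_even : ~~ odd (size l1). Proof. by rewrite size_tuple leg_even. Qed.
Let l2_even : ~~ odd (size l2). Proof. by rewrite size_tuple leg_even. Qed.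
Let st_even : ~~ odd (size st). Proof. by rewrite size_tuple leg_even. Qed.

Notation a := (size l1).
Notation b := (junction l1 st).
Notation N := (size S).

Let ab : (a < b)%N. Proof. exact: left_lt_junction. Qed.
Let bN : (b.+1 < N)%N. Proof. exact: junction_lt. Qed.
Let b_odd : odd b. Proof. exact: odd_junction. Qed.
Let N_even : ~~ odd N. Proof. exact: even_snake. Qed.

Let in_D_adj c x y : in_D c x y ->
  [/\ x \in S, y \in S & dadj a b N c (index x S) (index y S)].
Proof. exact: dumbbell_dadj. Qed.

Let gap : (4 * T <= branch_gap a b N)%N.
Proof.
rewrite /branch_gap size_snake /junction !size_tuple.
exact: dumbbell_gap_le.
Qed.

Let S_size : (N <= 12 * T)%N.
Proof.
by rewrite size_snake !size_tuple three_legs_le.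
Qed.

(** Each length up to [4 * T] has at most two walks in D, and the factors [g^-1 ^+ i.+1] sum to at
    most [eps^-1]; this gives [reach]. *)
Let A_rows c x : \sum_(i < 4 * T) rowsum A i.+1 c x <= h x.
Proof.
apply: (@le_trans _ _ (\sum_(i < 4 * T) g^-1 ^+ i.+1 * (2 * (x \in S)%:R))).
  apply: ler_sum => i _; rewrite /rowsum.
  under eq_bigr do rewrite /A ker_scale.
  rewrite -mulr_sumr ler_wpM2l ?exprn_ge0 ?invr_ge0 ?(ltW g_gt0) //.
  apply: (rowsum_step01 R l1_gt0 ab bN l1_even b_odd N_even S_uniq erefl in_D_adj).
  exact: leq_trans gap.
rewrite -mulr_suml (_ : h x = eps^-1 * (2 * (x \in S)%:R)); last first.
  by rewrite /h /reach; ring.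
rewrite ler_wpM2r ?mulr_ge0 //.
exact: sum_geometric_le.
Qed.

Let h_sum : \sum_x h x <= n * (12 * T%:R * H / n).
Proof.
rewrite (_ : n * _ = (12 * T)%:R * H); last first.
  by rewrite natrM; field; rewrite gt_eqF.
under eq_bigr do rewrite /h mulrC.
exact: sum_mem_le.
Qed.

Let h_ge0 x : 0 <= h x.
Proof. by rewrite mulr_ge0. Qed.

Let ker_M k c x y : (k <= 4 * T)%N ->
  ker M k c x y <= ker A k c x y + Y / n * (1 + h x) * (1 + h y).
Proof. exact: ker_perturb. Qed.

Let ker_A k c x y : g ^+ k * ker A k c x y = ker (step01 R in_D) k c x y.
Proof.
by rewrite /A ker_scale mulrA -exprMn divff ?expr1n ?mul1r // gt_eqF.
Qed.

Let sum_ker_A c x y :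
  \sum_(i < T) g ^+ (2 * (T + i)).+1 * ker A (2 * (T + i)).+1 c x y
  <= 2 * (x \in S)%:R * (y \in S)%:R.
Proof.
under eq_bigr do rewrite ker_A.
apply: (sum_ker_step01 R l1_gt0 ab bN l1_even b_odd N_even S_uniq erefl in_D_adj).
exact: leqW.
Qed.

Let len_le (i : 'I_T) : ((2 * (T + i)).+1 <= 4 * T)%N.
Proof. exact/ltnW/leg_lt. Qed.

Let sum_ker_M c x y :
  \sum_(i < T) g ^+ (2 * (T + i)).+1 * ker M (2 * (T + i)).+1 c x y
  <= 2 * (x \in S)%:R * (y \in S)%:R + G * Y / n * (1 + h x) * (1 + h y).
Proof.
apply: le_trans (lerD (sum_ker_A c x y) (lexx _)).
rewrite (_ : G * Y / n * _ * _ = G * (Y / n * (1 + h x) * (1 + h y))); last by ring.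
rewrite mulr_suml -big_split /=; apply: ler_sum => i _.
rewrite -mulrDr ler_wpM2l ?exprn_ge0 ?(ltW g_gt0) //.
exact: ker_M.
Qed.

Let weighted_loop x : R :=
  \sum_(i < T) g ^+ (2 * (T + i)).+1 * loop M (2 * (T + i)).-1 true x.

Let branch_pts := [:: nth u0 S a; nth u0 S b].

(** The term [2 * (x \in S)%:R] pays for loops lying inside D. It vanishes off D, and on D it is
    affordable only at the two junctions. *)
Let weighted_loop_le_ker x : weighted_loop x <=
  2 * (x \in S)%:R + G * Y / n * (1 + h x) ^+ 2.
Proof.
apply: (@le_trans _ _
  (\sum_(i < T) g ^+ (2 * (T + i)).+1 * ker M (2 * (T + i)).+1 true x x)).
  apply: ler_sum => i _; rewrite ler_wpM2l ?exprn_ge0 ?(ltW g_gt0) //.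
  by rewrite -{2}leg_predK loop_le_ker ?leg_pred_odd.
apply: le_trans (sum_ker_M _ _ _) _.
by rewrite expr2 !mulrA lerD2r; case: (x \in S); rewrite ?mulr1 ?mulr0.
Qed.

(** Away from the junctions at most one red edge of D leaves [x], so one end step of the loop can be
    charged [n^-1]. *)
Let weighted_loop_nobranch x : x \notin branch_pts ->
  weighted_loop x <= 2 * (G * Y / n) * (1 + h x).
Proof.
move=> xb.
rewrite (_ : 2 * (G * Y / n) * _ = G * (2 * (Y / n) * (1 + h x))); last by ring.
rewrite mulr_suml; apply: ler_sum => i _.
rewrite ler_wpM2l ?exprn_ge0 ?(ltW g_gt0) //.
apply: loop_perturb_nobranch => //; first exact: leg_pred_odd.
  exact: leg_pred_lt.
move=> z z' zz'; apply/eqP; apply: contraNT xb => nz.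
have nz' : step01 R in_D true x z * step01 R in_D true x z' != 0.
  by apply: contraNneq nz => e; rewrite /A mulrACA e mulr0.
have xS : x \in S.
  move: nz'; rewrite mulf_eq0 negb_or pnatr_eq0 eqb0 negbK => /andP[xz _].
  by case: (in_D_adj xz).
have := step01_branch l1_gt0 ab bN l1_even b_odd N_even erefl in_D_adj nz' zz'.
by rewrite !inE; case=> <-; rewrite nth_index // eqxx ?orbT.
Qed.

Let P := G * Y / n.

Let P_ge0 : 0 <= P.
Proof. by rewrite divr_ge0 ?mulr_ge0 // ltW. Qed.

(** The three terms come from all vertices, from the at most [12 * T] vertices of D, and from its
    two junctions. *)
Definition main_sum : R := G * Y + 12 * T%:R * (2 * (G * Y / n) * (1 + H) ^+ 2)
  + 2 * ((1 + H) * (2 + G * Y / n * (1 + H) ^+ 2)).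

Definition overlap_sum : R := 12 * T%:R * (2 * (G * Y / n) * (1 + H))
  + 2 * (2 + G * Y / n * (1 + H) ^+ 2).

(** The first term is for connecting paths with a step of weight [1 / n], the second for those
    inside D, which have both ends on D. *)
Definition pair_bound : R := G * Y / n * main_sum ^+ 2 + 2 * overlap_sum ^+ 2.

Let weighted_loop_ge0 x : 0 <= weighted_loop x.
Proof.
apply: sumr_ge0 => i _; rewrite mulr_ge0 ?exprn_ge0 ?(ltW g_gt0) //.
exact: loop_ge0.
Qed.

Let main_sum_ge : \sum_x weighted_loop x * (1 + h x) <= main_sum.
Proof.
have PH : 0 <= 2 * P * (1 + H) ^+ 2 by rewrite mulr_ge0 ?exprn_ge0 // mulr_ge0.
have PB : 0 <= (1 + H) * (2 + P * (1 + H) ^+ 2).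
  by rewrite mulr_ge0 ?addr_ge0 // mulr_ge0 // exprn_ge0.
apply: (@le_trans _ _ (\sum_x (P + (x \in S)%:R * (2 * P * (1 + H) ^+ 2)
  + (x \in branch_pts)%:R * ((1 + H) * (2 + P * (1 + H) ^+ 2))))).
  apply: ler_sum => x _.
  have [xb|xb] := boolP (x \in branch_pts).
    apply: (@le_trans _ _ ((2 * (x \in S)%:R + P * (1 + h x) ^+ 2) * (1 + h x))).
      by rewrite ler_wpM2r ?addr_ge0 ?weighted_loop_le_ker.
    rewrite /h; move: P_ge0 H_ge0 PH PB.
    by case: (x \in S); rewrite ?mulr1 ?mulr0 ?mul1r ?mul0r; nra.
  have [xS|xS] := boolP (x \in S).
    apply: (@le_trans _ _ (2 * P * (1 + h x) * (1 + h x))).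
      by rewrite ler_wpM2r ?addr_ge0 ?weighted_loop_nobranch.
    rewrite /h xS mulr1 mul1r mul0r addr0 -mulrA -expr2.
    by rewrite lerDr.
  rewrite mul0r mul0r !addr0 /h (negPf xS) mulr0 addr0 mulr1.
  apply: le_trans (weighted_loop_le_ker x) _.
  by rewrite -/P /h (negPf xS) !mulr0 addr0 add0r expr1n mulr1.
rewrite !big_split /= /main_sum -/P; apply: lerD; first apply: lerD.
- by rewrite sumr_const -[P *+ _]mulr_natr /P divfK // gt_eqF.
- by rewrite -natrM sum_mem_le.
- by rewrite sum_mem_le.
Qed.

Let overlap_sum_ge : \sum_x (x \in S)%:R * weighted_loop x <= overlap_sum.
Proof.
have PH : 0 <= 2 * P * (1 + H) by rewrite mulr_ge0 // mulr_ge0.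
have PB : 0 <= 2 + P * (1 + H) ^+ 2.
  by rewrite addr_ge0 // mulr_ge0 // exprn_ge0.
apply: (@le_trans _ _ (\sum_x ((x \in S)%:R * (2 * P * (1 + H))
  + (x \in branch_pts)%:R * (2 + P * (1 + H) ^+ 2)))).
  apply: ler_sum => x _.
  have [xS|xS] := boolP (x \in S); last first.
    by rewrite !mul0r add0r mulr_ge0.
  rewrite !mul1r; have [xb|xb] := boolP (x \in branch_pts).
    apply: le_trans (weighted_loop_le_ker x) _.
    by rewrite -/P /h xS !mulr1 mul1r lerDr.
  apply: le_trans (weighted_loop_nobranch xb) _.
  by rewrite -/P /h xS mulr1 mul0r addr0.
rewrite !big_split /= /overlap_sum -/P; apply: lerD.
- by rewrite -natrM sum_mem_le.
- by rewrite sum_mem_le.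
Qed.

Let W (e : colored_edge V) : R := g / n + (e \in D)%:R.

Let W_perturb e : W e = g * (n^-1 + g^-1 * (e \in D)%:R).
Proof. by rewrite mulrDr mulrA divff ?mul1r // gt_eqF. Qed.

Let W_ge0 e : 0 <= W e.
Proof. by rewrite addr_ge0 // divr_ge0 // ltW. Qed.

Let sum_stick (i : 'I_T) c x y :
  \sum_(s : (2 * (T + i)).-tuple V) \prod_(e <- alt_path c x (rcons s y)) W e
  = g ^+ (2 * (T + i)).+1 * ker M (2 * (T + i)).+1 c x y.
Proof.
under eq_bigr do under eq_bigr do rewrite W_perturb.
by rewrite (sum_alt_walk (fun e => g * (n^-1 + g^-1 * (e \in D)%:R))) ker_scale.
Qed.

Let sum_loop (i : 'I_T) x :
  \sum_(s : (2 * (T + i)).-tuple V | uniq s) \prod_(e <- alt_path true x (rcons s x)) W e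
  <= g ^+ (2 * (T + i)).+1 * loop M (2 * (T + i)).-1 true x.
Proof.
under eq_bigr do under eq_bigr do rewrite W_perturb.
apply: le_trans (sum_alt_loop _ _ _ _ _) _; rewrite ?leg_gt0 ?leg_even //.
  by move=> e; rewrite -W_perturb.
by rewrite loop_scale leg_predK.
Qed.

Lemma overlap_bound :
  \sum_(i < T) \sum_(j < T) \sum_(k < T) \sum_u \sum_w
  \sum_(m1 : (2 * (T + i)).-tuple V) \sum_(t : (2 * (T + j)).-tuple V)
  \sum_(m2 : (2 * (T + k)).-tuple V | uniq (snake u w m1 t m2))
    \prod_(e <- dumbbell u w m1 t m2) (g / n + (e \in D)%:R)
  <= pair_bound.
Proof.
(* Of the injectivity of the snake only the distinctness within [m1] and within [m2] is kept, so for
   given junctions the sum factors over the three legs. *)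
apply: (@le_trans _ _ (\sum_u \sum_w weighted_loop u * weighted_loop w *
  \sum_(j < T) g ^+ (2 * (T + j)).+1 * ker M (2 * (T + j)).+1 false u w)).
  rewrite [leRHS](_ : _ = \sum_(i < T) \sum_(j < T) \sum_(k < T) \sum_u \sum_w
    (g ^+ (2 * (T + i)).+1 * loop M (2 * (T + i)).-1 true u) *
    ((g ^+ (2 * (T + j)).+1 * ker M (2 * (T + j)).+1 false u w) *
     (g ^+ (2 * (T + k)).+1 * loop M (2 * (T + k)).-1 true w))); last first.
    have reorder (F : 'I_T -> 'I_T -> 'I_T -> V -> V -> R) :
        \sum_(i < T) \sum_(j < T) \sum_(k < T) \sum_u \sum_w F i j k u w
        = \sum_u \sum_w \sum_(i < T) \sum_(j < T) \sum_(k < T) F i j k u w.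
      transitivity (\sum_(i < T) \sum_(j < T) \sum_u \sum_w \sum_(k < T) F i j k u w).
        do 2 (apply: eq_bigr => ? _); rewrite exchange_big; apply: eq_bigr => u _.
        exact: exchange_big.
      transitivity (\sum_(i < T) \sum_u \sum_w \sum_(j < T) \sum_(k < T) F i j k u w).
        apply: eq_bigr => ? _; rewrite exchange_big; apply: eq_bigr => u _.
        exact: exchange_big.
      rewrite exchange_big; apply: eq_bigr => u _; exact: exchange_big.
    rewrite reorder; apply: eq_bigr => u _; apply: eq_bigr => w _.
    rewrite mulrAC -mulrA mulr_suml; apply: eq_bigr => i _.
    rewrite mulr_suml mulr_sumr; apply: eq_bigr => j _.
    by rewrite !mulr_sumr.
  apply: ler_sum => i _; apply: ler_sum => j _; apply: ler_sum => k _.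
  apply: ler_sum => u _; apply: ler_sum => w _.
  have prod0 r : 0 <= \prod_(e <- r) W e by apply: prodr_ge0.
  apply: (@le_trans _ _ (
    (\sum_(m1 : (2 * (T + i)).-tuple V | uniq m1)
       \prod_(e <- alt_path true u (rcons m1 u)) W e) *
    ((\sum_(t : (2 * (T + j)).-tuple V)
       \prod_(e <- alt_path false u (rcons t w)) W e) *
     (\sum_(m2 : (2 * (T + k)).-tuple V | uniq m2)
       \prod_(e <- alt_path true w (rcons m2 w)) W e)))); last first.
    rewrite sum_stick; apply: ler_pM (sum_loop _ _) _.
    - exact: sumr_ge0.
    - by rewrite !mulr_ge0 ?exprn_ge0 ?(ltW g_gt0) ?ker_ge0 // sumr_ge0.
    - rewrite ler_wpM2l ?sum_loop //.
      by rewrite mulr_ge0 ?exprn_ge0 ?(ltW g_gt0) ?ker_ge0.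
  rewrite big_distrlr /= big_distrlr [leRHS]big_mkcond /=.
  apply: ler_sum => m1 _; rewrite -[leRHS]/(if uniq m1 then _ else 0).
  have uniq_parts t m2 : uniq (snake u w m1 t m2) -> uniq m1 /\ uniq m2.
    rewrite /snake cat_uniq => /and3P[um1 _] /= /andP[_].
    by rewrite cat_uniq => /and3P[_ _ /= /andP[_ um2]].
  case: ifP => um1; last first.
    rewrite sumr_le0 // => t _; rewrite big_pred0 // => m2.
    by apply/negP => /uniq_parts[]; rewrite um1.
  apply: ler_sum => t _; rewrite mulr_sumr big_mkcond [leRHS]big_mkcond /=.
  apply: ler_sum => m2 _; case: ifP => [/uniq_parts[_ ->]|_].
    by rewrite !big_cat.
  by case: ifP => // _; rewrite !mulr_ge0.
(* The bound on the connecting path splits into two terms, each a product of a function of [u] and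
   one of [w], so both double sums become squares. *)
apply: (@le_trans _ _ (\sum_u \sum_w (P * ((weighted_loop u * (1 + h u)) *
    (weighted_loop w * (1 + h w))) + 2 * (((u \in S)%:R * weighted_loop u) *
    ((w \in S)%:R * weighted_loop w))))).
  apply: ler_sum => u _; apply: ler_sum => w _.
  apply: le_trans (ler_wpM2l _ (sum_ker_M _ _ _)) _; first by rewrite mulr_ge0.
  rewrite -/P le_eqVlt; apply/orP; left; apply/eqP; ring.
under eq_bigr do rewrite big_split -!mulr_sumr /=.
rewrite big_split -!mulr_sumr /= -!mulr_suml /pair_bound -/P !expr2.
have loops0 : 0 <= \sum_x weighted_loop x * (1 + h x).
  by apply: sumr_ge0 => x _; rewrite mulr_ge0 ?addr_ge0.
have overlaps0 : 0 <= \sum_x (x \in S)%:R * weighted_loop x.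
  by apply: sumr_ge0 => x _; rewrite mulr_ge0.
by apply: lerD; rewrite ler_wpM2l // ler_pM.
Qed.

End OverlapBound.

Lemma volume_gt0 (R : realFieldType) T (eps : R) : (0 < T)%N -> 0 < eps ->
  0 < volume T eps.
Proof.
case: T => // T _ eps0; have g0 : 0 < 1 + eps by rewrite addr_gt0.
rewrite /volume big_ord_recl ltr_pwDl ?exprn_gt0 //.
by apply: sumr_ge0 => i _; rewrite exprn_ge0 // ltW.
Qed.

Lemma pair_bound_gt0 (R : realFieldType) (V : finType) T (eps : R) :
  0 < #|V|%:R :> R -> (0 < T)%N -> 0 < eps -> 0 < pair_bound V T eps.
Proof.
move=> n0 T0 eps0; have G0 := volume_gt0 T0 eps0.
have H0 : 0 <= reach eps by rewrite divr_ge0 // ltW.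
have Y0 : 0 <= spread V T eps.
  rewrite exprn_ge0 // addr_ge0 // divr_ge0 ?(ltW n0) //.
  by rewrite mulr_ge0 // mulr_ge0.
have P0 : 0 <= volume T eps * spread V T eps / #|V|%:R.
  by rewrite divr_ge0 ?mulr_ge0 // ?(ltW G0) ?(ltW n0).
have H1 : 0 <= 1 + reach eps by rewrite addr_ge0.
have overlap0 : 0 < overlap_sum V T eps.
  have G1 := ltW G0; have n1 : 0 <= #|V|%:R^-1 :> R by rewrite invr_ge0 ltW.
  apply: ltr_wpDl; first by rewrite !mulr_ge0.
  by rewrite pmulr_rgt0 // ltr_pwDl // mulr_ge0 ?exprn_ge0.
apply: ltr_wpDl; first exact: mulr_ge0 P0 (sqr_ge0 _).
by rewrite pmulr_rgt0 ?exprn_gt0.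
Qed.

(** * Counting dumbbells *)

Section CountUniq.
Variables (R : realFieldType) (V : finType) (c : nat).

Lemma sum_uniq_cons (r : seq V) : (size r + c <= #|V|)%N ->
  (uniq r)%:R * c%:R <= \sum_z (uniq (z :: r))%:R :> R.
Proof.
move=> rc; case ur : (uniq r); last by rewrite mul0r sumr_ge0.
rewrite mul1r -natr_sum ler_nat.
rewrite (eq_bigr (fun z => if z \in [predC r] then 1%N else 0%N)); last first.
  by move=> z _; rewrite /= ur andbT inE /=; case: (z \in r).
rewrite -big_mkcond sum1_card -(cardC (mem r)) in rc *.
by rewrite (card_uniqP ur) leq_add2l in rc.
Qed.

(** Greedy choice: at every stage at least [c] vertices avoid those already taken. *)
Lemma sum_uniq_cat (k : nat) (r : seq V) : (size r + k + c <= #|V|)%N ->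
  (uniq r)%:R * c%:R ^+ k <= \sum_(s : k.-tuple V) (uniq (s ++ r))%:R :> R.
Proof.
elim: k r => [|k IH] r rc.
  rewrite expr0 mulr1 (big_pred1 [tuple]) => [//|s].
  by apply/esym/eqP; exact: tuple0.
rewrite (big_tuple_cons k (fun s => (uniq (s ++ r))%:R : R)).
have catC z s : uniq ((z :: s) ++ r) = uniq (s ++ z :: r).
  exact/esym/perm_uniq/permPl/(perm_catCA s [:: z] r).
under eq_bigr do under eq_bigr do rewrite catC.
apply: (@le_trans _ _ (\sum_z (uniq (z :: r))%:R * c%:R ^+ k)).
  rewrite -mulr_suml exprS mulrA ler_wpM2r ?exprn_ge0 ?sum_uniq_cons //.
  by apply: leq_trans rc; rewrite leq_add2r leq_addr.
by apply: ler_sum => z _; apply: IH; rewrite /= addSnnS.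
Qed.

Lemma sum_uniq_snake i j k : (i + j + k + 2 + c <= #|V|)%N ->
  c%:R ^+ (i + j + k).+2 <= \sum_u \sum_w \sum_(m1 : i.-tuple V)
    \sum_(t : j.-tuple V) \sum_(m2 : k.-tuple V) (uniq (snake u w m1 t m2))%:R :> R.
Proof.
move=> le_n.
have snakeC u w m1 t m2 :
    uniq (snake u w m1 t m2) = uniq (m2 ++ (t ++ (m1 ++ [:: w; u]))).
  apply: perm_uniq; rewrite /snake -[u :: _]/([:: u] ++ t ++ [:: w] ++ m2).
  by apply/permP => p; rewrite !count_cat /=; lia.
under eq_bigr do under eq_bigr do under eq_bigr do under eq_bigr do under eq_bigr do
  rewrite snakeC.
apply: (@le_trans _ _ (\sum_u \sum_w (uniq [:: w; u])%:R * c%:R ^+ (i + j + k))); last first.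
  apply: ler_sum => u _; apply: ler_sum => w _.
  rewrite !exprD !mulrA.
  apply: (@le_trans _ _ (\sum_(m1 : i.-tuple V) (uniq (m1 ++ [:: w; u]))%:R * c%:R ^+ j * c%:R ^+ k)).
    rewrite -!mulr_suml !ler_wpM2r ?exprn_ge0 //.
    by apply: sum_uniq_cat; apply: leq_trans le_n => /=; lia.
  apply: ler_sum => m1 _.
  apply: (@le_trans _ _ (\sum_(t : j.-tuple V) (uniq (t ++ m1 ++ [:: w; u]))%:R * c%:R ^+ k)).
    rewrite -!mulr_suml !ler_wpM2r ?exprn_ge0 //.
    by apply: sum_uniq_cat; apply: leq_trans le_n; rewrite size_cat size_tuple /=; lia.
  apply: ler_sum => t _; apply: sum_uniq_cat.
  by apply: leq_trans le_n; rewrite !size_cat !size_tuple /=; lia.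
under eq_bigr do rewrite -mulr_suml.
rewrite -mulr_suml -[(i + j + k).+2]addn2 addnC exprD.
rewrite ler_wpM2r ?exprn_ge0 // expr2.
apply: (@le_trans _ _ (\sum_u (uniq [:: u])%:R * c%:R)).
  rewrite -mulr_suml ler_wpM2r //.
  apply: le_trans (sum_uniq_cons _); rewrite ?mul1r //=.
  by apply: leq_trans le_n; lia.
by apply: ler_sum => u _; apply: sum_uniq_cons; apply: leq_trans le_n => /=; lia.
Qed.

End CountUniq.

Lemma bernoulli_le (R : realFieldType) (x : R) k : -1 <= x ->
  1 + k%:R * x <= (1 + x) ^+ k.
Proof.
move=> x1; elim: k => [|k IH]; first by rewrite mul0r addr0.
rewrite exprS -natr1; apply: le_trans (ler_wpM2l _ IH); last by lra.
have : 0 <= k%:R * x ^+ 2 by rewrite mulr_ge0 ?sqr_ge0.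
lra.
Qed.

(** * The second moment bound for fixed [n], [T] and [eps] *)

Section FiniteBound.
Variables (R : realType) (n T : nat) (eps : R).
Hypotheses (T_gt0 : (0 < T)%N) (eps_gt0 : 0 < eps) (nT : (12 * T <= n)%N).
Hypothesis p_le1 : 2 * (1 + eps) / n%:R <= 1.
Notation g := (1 + eps).
Notation G := (volume T eps).
Notation p := (2 * g / n%:R).

(** A dumbbell has [m.+3] edges on [m.+2] vertices, which leaves one factor [1 / n]. Distinctness of
    the at most [12 * T] vertices costs [(1 - 12 * T / n) ^ (12 * T)] at worst, and Bernoulli turns
    this into [1 - 144 * T ^ 2 / n]. *)
Lemma Pr_not_adaptable_ge :
  (1 - 144 * T%:R ^+ 2 / n%:R) * (G ^+ 3 / n%:R) / pair_bound 'I_n T eps <=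
  Pr_Gnp2 p (fun w : edge_colored_graph 'I_n => ~~ adaptably_2colorable w).
Proof.
have n_gt0 : 0 < n%:R :> R by rewrite ltr0n; lia.
have g_gt0 : 0 < g by rewrite addr_gt0.
have p01 : 0 <= p <= 1.
  by rewrite p_le1 andbT divr_ge0 ?mulr_ge0 // ltW.
pose I := ('I_T * 'I_T * 'I_T)%type.
pose J (t : I) := ('I_n * 'I_n * (2 * (T + t.1.1)).-tuple 'I_n *
  (2 * (T + t.1.2)).-tuple 'I_n * (2 * (T + t.2)).-tuple 'I_n)%type.
pose vertices t (d : J t) :=
  snake d.1.1.1.1 d.1.1.1.2 d.1.1.2 d.1.2 d.2.
pose edges t (d : J t) :=
  dumbbell d.1.1.1.1 d.1.1.1.2 d.1.1.2 d.1.2 d.2.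
have sumIJ (F : forall t, J t -> R) : \sum_(z : {t : I & J t} | uniq (vertices _ (tagged z))) F _ (tagged z)
   = \sum_(i < T) \sum_(j < T) \sum_(k < T) \sum_u \sum_w
  \sum_(m1 : (2 * (T + i)).-tuple 'I_n) \sum_(s : (2 * (T + j)).-tuple 'I_n)
  \sum_(m2 : (2 * (T + k)).-tuple 'I_n | uniq (snake u w m1 s m2)) F (i, j, k) (u, w, m1, s, m2).
  rewrite -(sig_big_dep xpredT (fun t d => uniq (vertices t d))) /=.
  rewrite pair_bigA pair_bigA /=; apply: eq_bigr => -[[i j] k] _ /=.
  do 3 rewrite pair_bigA /=.
  by rewrite pair_big_dep /=; apply: eq_big => [[[[[u w] m1] s] m2]|[[[[u w] m1] s] m2] _].
have b0 : 0 < pair_bound 'I_n T eps by apply: pair_bound_gt0; rewrite ?card_ord.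
have pE : p / 2 = g / n%:R by rewrite mulrAC [2 * g]mulrC mulrK // unitfE.
have even_legs t (d : J t) : [/\ ~~ odd (size d.1.1.2), ~~ odd (size d.1.2) & ~~ odd (size d.2)].
  by rewrite !size_tuple; split; apply: leg_even.
apply: le_trans (@second_moment R n p p01 {t : I & J t}
  (fun z => uniq (vertices _ (tagged z))) (fun z => edges _ (tagged z))
  _ (pair_bound 'I_n T eps) b0 _ _ _).
- rewrite ler_wpM2r ?invr_ge0 ?(ltW b0) // pE.
  rewrite (sumIJ (fun t d => (g / n%:R) ^+ size (edges t d))).
  pose gg (i : 'I_T) : R := g ^+ (2 * (T + i)).+1.
  have -> : (1 - 144 * T%:R ^+ 2 / n%:R) * (G ^+ 3 / n%:R) =
      \sum_(i < T) \sum_(j < T) \sum_(k < T)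
        (1 - 144 * T%:R ^+ 2 / n%:R) * (gg i * (gg j * gg k) / n%:R).
    under eq_bigr do under eq_bigr do
      rewrite -mulr_sumr -mulr_suml -mulr_sumr -mulr_sumr.
    under eq_bigr do rewrite -mulr_sumr -mulr_suml -mulr_sumr -mulr_suml.
    by rewrite -mulr_sumr -2!mulr_suml -/(volume T eps); ring.
  apply: ler_sum => i _; apply: ler_sum => j _; apply: ler_sum => k _.
  set m := (2 * (T + i) + 2 * (T + j) + 2 * (T + k))%N.
  have m_le : (m.+2 <= 12 * T)%N by apply: three_legs_le.
  apply: (@le_trans _ _ ((g / n%:R) ^+ m.+3 * (n - 12 * T)%:R ^+ m.+2)).
    have x01 : 0 <= (12 * T%:R / n%:R : R) <= 1.
      apply/andP; split; first by rewrite divr_ge0 ?mulr_ge0 // ltW.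
      by rewrite ler_pdivrMr // mul1r -natrM ler_nat.
    have -> : (n - 12 * T)%:R = (1 - 12 * T%:R / n%:R) * n%:R :> R.
      by rewrite natrB // natrM; field; rewrite gt_eqF.
    have -> : (g / n%:R) ^+ m.+3 * ((1 - 12 * T%:R / n%:R) * n%:R) ^+ m.+2 =
        (1 - 12 * T%:R / n%:R) ^+ m.+2 * (g ^+ m.+3 / n%:R).
      rewrite !exprMn exprVn [n%:R ^+ m.+3]exprSr.
      have nm : n%:R ^+ m.+2 != 0 :> R by rewrite expf_neq0 ?gt_eqF.
      by move: (n%:R ^+ m.+2) nm => N2 nm; field; rewrite nm gt_eqF.
    have -> : g ^+ m.+3 = gg i * (gg j * gg k) by rewrite /gg -!exprD; congr (_ ^+ _); lia.
    rewrite ler_wpM2r ?divr_ge0 ?mulr_ge0 ?exprn_ge0 ?(ltW n_gt0) ?(ltW g_gt0) //.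
    have xm1 : -1 <= - (12 * T%:R / n%:R : R) by rewrite lerN2; case/andP: x01.
    apply: le_trans (bernoulli_le _ xm1); rewrite mulrN lerD2l lerN2.
    rewrite (_ : 144 * T%:R ^+ 2 / n%:R = (12 * T)%:R * (12 * T%:R / n%:R)); last first.
      by rewrite natrM; field; rewrite gt_eqF.
    by rewrite ler_wpM2r ?ler_nat //; case/andP: x01.
  have count : (2 * (T + i) + 2 * (T + j) + 2 * (T + k) + 2 + (n - 12 * T) <= #|'I_n|)%N.
    by rewrite card_ord -/m addn2; move: m_le nT; lia.
  have q0 : 0 <= (g / n%:R) ^+ m.+3 by rewrite exprn_ge0 // divr_ge0 // ltW.
  apply: le_trans (ler_wpM2l q0 (sum_uniq_snake R count)) _.
  rewrite mulr_sumr; apply: ler_sum => u _; rewrite mulr_sumr; apply: ler_sum => w _.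
  rewrite mulr_sumr; apply: ler_sum => m1 _; rewrite mulr_sumr; apply: ler_sum => s _.
  rewrite mulr_sumr [leRHS]big_mkcond /=; apply: ler_sum => m2 _.
  case: ifP => _; last by rewrite mulr0.
  rewrite mulr1 /edges /dumbbell !size_cat !size_alt_path !size_rcons !size_tuple /=.
  by rewrite (_ : (_ + _)%N = m.+3) // /m; lia.
- move=> [t d] /= dU; have [e1 e2 e3] := even_legs t d.
  by apply: dumbbell_edge_list; rewrite ?size_tuple ?leg_gt0 ?leg_even.
- move=> [t d] w _ /=; have [e1 e2 e3] := even_legs t d.
  exact: dumbbell_not_adaptable.
- move=> [t d] /= dU; rewrite pE.
  rewrite (sumIJ (fun t' d' => \prod_(x <- edges t' d') (g / n%:R + (x \in edges t d)%:R))).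
  have n_gt0' : 0 < #|'I_n|%:R :> R by rewrite card_ord.
  by have := overlap_bound n_gt0' eps_gt0 dU; rewrite card_ord.
Qed.

End FiniteBound.

(** * Asymptotics *)

(** The base of [spread] is [1 + 24 * T / (eps * n)]; with [1 / eps = t * k], [T <= t] and
    [t ^ 3 = n * k ^ 3], the excess times the exponent [4 * T] is at most [96 * k ^ 4]. *)
Definition spread_cap (R : realFieldType) (k : R) : R := (1 - 96 * k ^+ 4)^-1.

(** A bound on [pair_bound] divided by [volume ^ 3 / n]; it tends to 1 with [k] tending to 0. *)
Definition ratio_cap (R : realFieldType) (k : R) : R :=
  let y := spread_cap k in
  y * (y * (1 + 216 * k ^+ 5 + 54 * k ^+ 6) + 24 * k) ^+ 2
  + 6 * (5184 * y ^+ 2 * k ^+ 5 + 8192 * k ^+ 3 + 648 * y ^+ 2 * k ^+ 7).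

Lemma sqr3_le (R : realFieldType) (x y z : R) :
  (x + y + z) ^+ 2 <= 3 * (x ^+ 2 + y ^+ 2 + z ^+ 2).
Proof.
have := sqr_ge0 (x - y); have := sqr_ge0 (y - z); have := sqr_ge0 (x - z); nra.
Qed.

Lemma ratio_le (R : realFieldType) (k Y y a b c d f : R) :
  0 <= k -> 0 <= Y <= y -> 0 <= a <= 9 * k ^+ 5 -> 0 <= b <= 27 * k ^+ 6 ->
  0 <= c <= 6 * k -> d <= 512 * k ^+ 3 -> 0 <= f <= 1 ->
  Y * (Y * (1 + 24 * a + 2 * b) + 4 * c) ^+ 2
  + 6 * (576 * Y ^+ 2 * (a * f) + 16 * d + 4 * Y ^+ 2 * (b * c))
  <= y * (y * (1 + 216 * k ^+ 5 + 54 * k ^+ 6) + 24 * k) ^+ 2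
     + 6 * (5184 * y ^+ 2 * k ^+ 5 + 8192 * k ^+ 3 + 648 * y ^+ 2 * k ^+ 7).
Proof.
move=> k0 /andP[Y0 Yy] /andP[a0 a_le] /andP[b0 b_le] /andP[c0 c_le] d_le /andP[f0 f1].
have y0 : 0 <= y := le_trans Y0 Yy.
have Y2 : Y ^+ 2 <= y ^+ 2 by rewrite lerXn2r ?nnegrE.
have Y20 : 0 <= Y ^+ 2 by rewrite exprn_ge0.
apply: lerD.
  rewrite (_ : 216 * k ^+ 5 = 24 * (9 * k ^+ 5)); last by ring.
  rewrite (_ : 54 * k ^+ 6 = 2 * (27 * k ^+ 6)); last by ring.
  rewrite (_ : 24 * k = 4 * (6 * k)); last by ring.
  apply: ler_pM; rewrite ?sqr_ge0 // lerXn2r ?nnegrE //.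
  - by rewrite addr_ge0 ?mulr_ge0 ?addr_ge0 ?mulr_ge0.
  - by rewrite addr_ge0 ?mulr_ge0 ?addr_ge0 ?mulr_ge0 ?exprn_ge0.
  - apply: lerD; last by rewrite ler_wpM2l.
    apply: ler_pM => //; first by rewrite !addr_ge0 ?mulr_ge0.
    by apply: lerD; [apply: lerD => //|]; rewrite ler_wpM2l.
rewrite ler_wpM2l //; apply: lerD; first apply: lerD.
- rewrite (_ : 5184 * _ * _ = 576 * y ^+ 2 * (9 * k ^+ 5 * 1)); last by ring.
  apply: (ler_pM (mulr_ge0 (ler0n _ _) Y20) (mulr_ge0 a0 f0)).
    exact: ler_wpM2l (ler0n _ _) _ _ Y2.
  exact: ler_pM a0 f0 a_le f1.
- rewrite (_ : 8192 * _ = 16 * (512 * k ^+ 3)); last by ring.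
  exact: ler_wpM2l (ler0n _ _) _ _ d_le.
- rewrite (_ : 648 * _ * _ = 4 * y ^+ 2 * (27 * k ^+ 6 * (6 * k))); last by ring.
  apply: (ler_pM (mulr_ge0 (ler0n _ _) Y20) (mulr_ge0 b0 c0)).
    exact: ler_wpM2l (ler0n _ _) _ _ Y2.
  exact: ler_pM b0 c0 b_le c_le.
Qed.

(* Here [k] is [lambda ^ (- 1 / 2)] and [t = n ^ (1 / 3) * k], so that
   [1 / eps = t * k]. *)
Lemma pair_sum_le (R : realFieldType) (n T t k H G Y y : R) :
  0 < k -> 0 < T -> T <= t -> t <= 2 * T -> 0 < n -> n * k ^+ 3 = t ^+ 3 ->
  1 <= t * k -> H = 2 * (t * k) -> T <= G -> n <= 512 * k ^+ 3 * G ^+ 3 ->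
  0 <= Y <= y ->
  G * Y / n * (G * Y + 12 * T * (2 * (G * Y / n) * (1 + H) ^+ 2)
                + 2 * ((1 + H) * (2 + G * Y / n * (1 + H) ^+ 2))) ^+ 2
  + 2 * (12 * T * (2 * (G * Y / n) * (1 + H))
          + 2 * (2 + G * Y / n * (1 + H) ^+ 2)) ^+ 2
  <= G ^+ 3 / n * (y * (y * (1 + 216 * k ^+ 5 + 54 * k ^+ 6) + 24 * k) ^+ 2
     + 6 * (5184 * y ^+ 2 * k ^+ 5 + 8192 * k ^+ 3 + 648 * y ^+ 2 * k ^+ 7)).
Proof.
move=> k0 T0 Tt tT n0 nk tk HE TG nG /andP[Y0 Yy].
have t0 : 0 < t by lra.
have G0 : 0 < G by lra.
have nz : n != 0 by rewrite gt_eqF.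
have Gz : G != 0 by rewrite gt_eqF.
pose a := T * (1 + H) ^+ 2 / n.
pose b := (1 + H) ^+ 3 / n.
pose c := (1 + H) / G.
pose d := n / G ^+ 3.
pose f := T / G.
have H1 : 0 <= 1 + H by rewrite HE; nra.
have H3 : 1 + H <= 3 * (t * k) by rewrite HE; lra.
have a0 : 0 <= a by rewrite divr_ge0 ?mulr_ge0 ?exprn_ge0 // ltW.
have b0 : 0 <= b by rewrite divr_ge0 ?exprn_ge0 // ltW.
have c0 : 0 <= c by rewrite divr_ge0 // ltW.
have f0 : 0 <= f by rewrite divr_ge0 // ltW.
have tk0 : 0 <= 3 * (t * k) by lra.
have a_le : a <= 9 * k ^+ 5.
  rewrite ler_pdivrMr // (_ : 9 * k ^+ 5 * n = t * (3 * (t * k)) ^+ 2); last first.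
    by transitivity (9 * k ^+ 2 * (n * k ^+ 3)); [ring | rewrite nk; ring].
  by apply: ler_pM => //; rewrite ?exprn_ge0 ?lerXn2r ?nnegrE // (ltW T0).
have b_le : b <= 27 * k ^+ 6.
  rewrite ler_pdivrMr // (_ : 27 * k ^+ 6 * n = (3 * (t * k)) ^+ 3); last first.
    by transitivity (27 * k ^+ 3 * (n * k ^+ 3)); [ring | rewrite nk; ring].
  by rewrite lerXn2r ?nnegrE.
have c_le : c <= 6 * k.
  rewrite ler_pdivrMr //; apply: le_trans H3 _.
  have : k * t <= k * (2 * G) by rewrite ler_wpM2l ?(ltW k0) //; lra.
  lra.
have d_le : d <= 512 * k ^+ 3 by rewrite ler_pdivrMr ?exprn_gt0.
have f1 : f <= 1 by rewrite ler_pdivrMr // mul1r.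
have y0 : 0 <= y by lra.
set S1 := _ + _ + _.
have -> : S1 = G * (Y * (1 + 24 * a + 2 * b) + 4 * c).
  by rewrite /S1 /a /b /c; field; rewrite nz Gz.
(* The overlap sum is cut into three terms, whose squares are added at the cost of a factor 3. *)
set x1 := 12 * T * _; rewrite [2 * (2 + _)]mulrDr addrA.
set x2 := 2 * 2; set x3 := 2 * (_ * _).
apply: (@le_trans _ _ (G ^+ 3 / n * (Y * (Y * (1 + 24 * a + 2 * b) + 4 * c) ^+ 2
  + 6 * (576 * Y ^+ 2 * (a * f) + 16 * d + 4 * Y ^+ 2 * (b * c))))).
  rewrite [leRHS]mulrDr; apply: lerD.
    by rewrite le_eqVlt; apply/orP; left; apply/eqP; field.
  rewrite (_ : G ^+ 3 / n * _ = 2 * (3 * (x1 ^+ 2 + x2 ^+ 2 + x3 ^+ 2))).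
    by rewrite ler_wpM2l // sqr3_le.
  by rewrite /x1 /x2 /x3 /a /b /c /d /f; field; rewrite nz Gz.
rewrite ler_wpM2l ?divr_ge0 ?exprn_ge0 ?(ltW G0) ?(ltW n0) //.
by apply: ratio_le => //; [exact: ltW | rewrite Y0 | rewrite a0 | rewrite b0 | rewrite c0 | rewrite f0].
Qed.

(** Multiply by [1 - m x], which is at most [(1 - x) ^ m] by Bernoulli, and use
    [(1 + x) (1 - x) <= 1]. *)
Lemma expr1D_le (R : realFieldType) (x : R) m : 0 <= x -> m%:R * x < 1 ->
  (1 + x) ^+ m <= (1 - m%:R * x)^-1.
Proof.
case: m => [|m] x0 mx; first by rewrite mul0r subr0 invr1.
have x1 : x <= 1.
  apply: le_trans (ltW mx); rewrite ler_peMl // ler1n.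
  by [].
rewrite -[leRHS]mul1r ler_pdivlMr ?subr_gt0 //.
have xm1 : -1 <= - x by rewrite lerN2.
rewrite -mulrN; apply: le_trans (ler_wpM2l _ (bernoulli_le m.+1 xm1)) _.
  by rewrite exprn_ge0 // addr_ge0.
by rewrite -exprMn exprn_ile1 //; nra.
Qed.

Lemma Pr_not_adaptable_cap (R : realType) (n : nat) (t k eps : R) :
  0 < k -> 96 * k ^+ 4 < 1 -> 144 * k ^+ 3 <= 1 ->
  n%:R * k ^+ 3 = t ^+ 3 -> 1 <= t -> t * k * eps = 1 -> 0 < eps <= 1 ->
  4 <= n%:R :> R ->
  (1 - 144 * k ^+ 3) / ratio_cap k <=
  Pr_Gnp2 (2 * (1 + eps) / n%:R)
    (fun w : edge_colored_graph 'I_n => ~~ adaptably_2colorable w).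
Proof.
move=> k0 k4 k3 nk t1 tke /andP[eps0 eps1] n4.
have t0 : 0 < t by apply: lt_le_trans t1.
have n0 : 0 < n%:R :> R by apply: lt_le_trans n4.
have k30 : 0 <= k ^+ 3 by rewrite exprn_ge0 // ltW.
(* [T] is the integer part of [t]; since [t >= 1] this gives [T >= 1] and [t <= 2 T]. *)
have [T Tt tT] : exists2 T : nat, T%:R <= t & t < T%:R + 1.
  exists (Num.truncn t); have /andP[] := Num.Theory.truncn_itv (ltW t0) => // _.
  by rewrite natr1.
have T_gt0 : (0 < T)%N by rewrite -(@ltr_nat R); lra.
have T1 : 1 <= T%:R :> R by rewrite ler1n.
have T0 : 0 < T%:R :> R by rewrite ltr0n.
have tT2 : t <= 2 * T%:R by lra.
have tk : t * k = eps^-1 by rewrite -[RHS]mul1r -tke mulfK // gt_eqF.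
have tk1 : 1 <= t * k by rewrite tk invf_ge1.
have t3 : t <= t ^+ 3 by rewrite ler_eXnr.
have nT : (12 * T <= n)%N.
  have : 144 * k ^+ 3 * n%:R <= 1 * n%:R by rewrite ler_wpM2r // ltW.
  rewrite -(ler_nat R) natrM; move: nk; move: (k ^+ 3) (t ^+ 3) t3 => k3' t3'; nra.
have p1 : 2 * (1 + eps) / n%:R <= 1.
  by rewrite ler_pdivrMr // mul1r; lra.
have := Pr_not_adaptable_ge T_gt0 eps0 nT p1; apply: le_trans.
have G0 : 0 < volume T eps by apply: volume_gt0.
have b0 : 0 < pair_bound 'I_n T eps by apply: pair_bound_gt0; rewrite ?card_ord.
have G_ge : T%:R * (1 + eps) ^+ (2 * T) <= volume T eps.
  rewrite mulrC mulr_natr -[T in _ *+ T]card_ord -sumr_const.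
  apply: ler_sum => i _; apply: ler_weXn2l; first by rewrite lerDl ltW.
  by rewrite leqW // leq_mul2l leq_addr orbT.
have TG : T%:R <= volume T eps.
  by apply: le_trans G_ge; rewrite ler_peMr ?(ltW T0) // exprn_ege1 // lerDl ltW.
have Te : 1 <= T%:R * eps * (2 * k).
  have : t * (k * eps) <= 2 * T%:R * (k * eps) by rewrite ler_wpM2r ?mulr_ge0 ?(ltW k0) ?(ltW eps0).
  by rewrite mulrA tke; lra.
have g_ge : 1 <= (1 + eps) ^+ T * (2 * k).
  apply: le_trans Te _; rewrite ler_wpM2r ?mulr_ge0 ?(ltW k0) //.
  have epsm1 : -1 <= eps by lra.
  by apply: le_trans (bernoulli_le T epsm1); rewrite lerDr.
(* The expected count is large: [n k ^ 3 = t ^ 3 <= (2 T) ^ 3], and multiplying by the sixth power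
   of [(1 + eps) ^ T * 2 k >= 1] produces [512 k ^ 6] times the cube of the lower bound [G_ge]. *)
have nG : n%:R <= 512 * k ^+ 3 * volume T eps ^+ 3.
  have k30' : 0 < k ^+ 3 by rewrite exprn_gt0.
  rewrite -(ler_pM2r k30') nk.
  apply: (@le_trans _ _ ((2 * T%:R) ^+ 3)).
    by rewrite lerXn2r ?nnegrE ?mulr_ge0 // ltW.
  apply: (@le_trans _ _ ((2 * T%:R) ^+ 3 * ((1 + eps) ^+ T * (2 * k)) ^+ 6)).
    by rewrite ler_peMr ?exprn_ge0 ?mulr_ge0 // exprn_ege1.
  have G3 : (T%:R * (1 + eps) ^+ (2 * T)) ^+ 3 <= volume T eps ^+ 3.
    by rewrite lerXn2r ?nnegrE ?mulr_ge0 ?exprn_ge0 ?(ltW G0) // addr_ge0 // ltW.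
  have := ler_wpM2r (ltW k30') (ler_wpM2l (ltW k30') G3).
  rewrite mulnC exprM; move: ((1 + eps) ^+ T) => gT.
  have c512 : 0 <= 512 :> R := ler0n _ _.
  by move=> /(ler_wpM2l c512) G3'; apply: le_trans (le_trans _ G3') _;
    rewrite le_eqVlt; apply/orP; left; apply/eqP; ring.
have Y_le : 0 <= spread 'I_n T eps <= spread_cap k.
  have reach0 : 0 <= 12 * T%:R * reach eps / n%:R.
    have r0 : 0 <= reach eps := divr_ge0 (ler0n _ _) (ltW eps0).
    by rewrite divr_ge0 ?(ltW n0) // mulr_ge0 // mulr_ge0.
  rewrite /spread /spread_cap card_ord exprn_ge0 ?addr_ge0 //=.
  have mx : (4 * T)%:R * (12 * T%:R * reach eps / n%:R) <= 96 * k ^+ 4.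
    rewrite mulrA ler_pdivrMr // /reach -tk natrM.
    have Tt2 : T%:R ^+ 2 <= t ^+ 2 by rewrite lerXn2r ?nnegrE ?(ltW T0) ?(ltW t0).
    have tk0 : 0 <= 96 * (t * k) by rewrite mulr_ge0 // mulr_ge0 ?(ltW t0) ?(ltW k0).
    have -> : 96 * k ^+ 4 * n%:R = 96 * (t * k) * t ^+ 2.
      by transitivity (96 * k * (n%:R * k ^+ 3)); [ring | rewrite nk; ring].
    apply: le_trans (ler_wpM2l tk0 Tt2).
    by rewrite le_eqVlt; apply/orP; left; apply/eqP; ring.
  have mx1 := le_lt_trans mx k4.
  apply: le_trans (expr1D_le reach0 mx1) _.
  by rewrite lef_pV2 ?posrE ?subr_gt0 // lerD2l lerN2.
have pair_le : pair_bound 'I_n T eps <= volume T eps ^+ 3 / n%:R * ratio_cap k.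
  rewrite /pair_bound /main_sum /overlap_sum card_ord.
  by apply: (pair_sum_le (t := t)); rewrite // /reach tk.
have c0 : 0 < volume T eps ^+ 3 / n%:R by rewrite divr_gt0 // exprn_gt0.
have ratio0 : 0 < ratio_cap k.
  by rewrite -(pmulr_rgt0 _ c0); apply: lt_le_trans pair_le.
rewrite -mulrA; apply: ler_pM.
- by rewrite subr_ge0.
- by rewrite invr_ge0 ltW.
- rewrite lerD2l lerN2 -mulrA ler_wpM2l // ler_pdivrMr // mulrC nk.
  apply: (@le_trans _ _ (t ^+ 2)); first by rewrite lerXn2r ?nnegrE ?(ltW T0) ?(ltW t0).
  by apply: ler_weXn2l.
- by rewrite ler_pdivlMr // mulrC ler_pdivrMr.
Qed.

Local Open Scope classical_set_scope.

Lemma cvg_cap_ratio (R : realType) (k : nat -> R) :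
  k n @[n --> \oo] --> (0 : R) ->
  ((1 - 144 * k n ^+ 3) / ratio_cap (k n)) @[n --> \oo] --> (1 : R).
Proof.
move=> k0.
have lim_eq (f : nat -> R) (l l' : R) : l = l' ->
  f n @[n --> \oo] --> l -> f n @[n --> \oo] --> l' by move=> ->.
have X m c : (c * k n ^+ m.+1) @[n --> \oo] --> (0 : R).
  apply: (lim_eq _ _ _ (mulr0 c)); apply: cvgMr.
  elim: m => [//|m IH]; under eq_fun do rewrite exprS.
  by apply: (lim_eq _ _ _ (mul0r 0)); apply: cvgM.
have XD (l : R) (f g : nat -> R) :
    f n @[n --> \oo] --> l -> g n @[n --> \oo] --> (0 : R) ->
    (f n + g n) @[n --> \oo] --> l.
  by move=> fl g0; apply: (lim_eq _ _ _ (addr0 _)); apply: cvgD.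
have XB (l : R) (f g : nat -> R) :
    f n @[n --> \oo] --> l -> g n @[n --> \oo] --> (0 : R) ->
    (f n - g n) @[n --> \oo] --> l.
  by move=> fl g0; apply: (lim_eq _ _ _ (subr0 _)); apply: cvgB.
have c1 : (fun _ : nat => 1 : R) n @[n --> \oo] --> (1 : R) by apply: cvg_cst.
have V1 (f : nat -> R) : f n @[n --> \oo] --> (1 : R) ->
    (f n)^-1 @[n --> \oo] --> (1 : R).
  by move=> f1; apply: (lim_eq _ _ _ (invr1 _)); apply: cvgV.
have M1 (f g : nat -> R) : f n @[n --> \oo] --> (1 : R) -> g n @[n --> \oo] --> (1 : R) ->
    (f n * g n) @[n --> \oo] --> (1 : R).
  by move=> f1 g1; apply: (lim_eq _ _ _ (mulr1 _)); apply: cvgM.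
have Y1 : spread_cap (k n) @[n --> \oo] --> (1 : R) by apply: (V1); apply: (XB).
have YX c m : (c * spread_cap (k n) ^+ 2 * k n ^+ m.+1) @[n --> \oo] --> (0 : R).
  under eq_fun do rewrite -mulrA mulrCA expr2.
  by apply: (lim_eq _ _ _ (mulr0 1)); apply: cvgM => //; apply: (M1).
apply: (M1); first exact: XB.
apply: (V1); apply: (XD).
  apply: (M1) => //; under eq_fun do rewrite expr2.
  have kX : (24 * k n) @[n --> \oo] --> (0 : R) by apply: (X 0).
  by apply: (M1); apply: (XD) => //; apply: (M1) => //; do 2 apply: (XD) => //.
apply: (lim_eq _ _ _ (mulr0 6)); apply: cvgMr.
by apply: (XD) => //; apply: (lim_eq _ _ _ (addr0 _)); apply: cvgD.
Qed.

Theorem theorem1p6 (R : realType) (lambda : nat -> R)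
  (lambda_gt0 : forall n, 0 < lambda n)
  (lambda_infty : lambda n @[n --> \oo] --> +oo)
  (lambda_small : lambda n / n%:R `^ (1 / 3) @[n --> \oo] --> (0 : R)) :
  Pr_Gnp2 (2 * (1 + lambda n * n%:R `^ (- (1 / 3))) / n%:R)
    (fun w : edge_colored_graph 'I_n => ~~ adaptably_2colorable w)
    @[n --> \oo] --> (1 : R).
Proof.
(* With [t = n ^ (1 / 3) * k] and [eps = lambda / n ^ (1 / 3)] this choice gives
   [t * k * eps = k ^ 2 * lambda = 1]. *)
pose k n := (Num.sqrt (lambda n))^-1.
have k_gt0 n : 0 < k n by rewrite invr_gt0 sqrtr_gt0.
have k2 n : k n ^+ 2 * lambda n = 1.
  by rewrite exprVn sqr_sqrtr ?ltW // mulVf // gt_eqF.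
have lambda_big := (cvgryPgt lambda).1 lambda_infty.
have k_small e : 0 < e -> \forall n \near \oo, k n < e.
  move=> e0; near=> n.
  rewrite -[ltRHS]invrK ltf_pV2 ?posrE ?invr_gt0 ?sqrtr_gt0 //.
  have -> : e^-1 = Num.sqrt (e^-1 ^+ 2) by rewrite sqrtr_sqr gtr0_norm ?invr_gt0.
  rewrite ltr_sqrt //.
  by near: n; apply: lambda_big.
have k0 : k n @[n --> \oo] --> (0 : R).
  apply/cvgr0Pnorm_lt => e e0; near=> n; rewrite gtr0_norm //.
  by near: n; apply: k_small.
apply: (@squeeze_cvgr _ _ _ _ (fun n => (1 - 144 * k n ^+ 3) / ratio_cap (k n)) (fun=> 1)); last 2 first.
- exact: cvg_cap_ratio.
- exact: cvg_cst.
near=> n.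
have n4 : 4 <= n%:R :> R by rewrite ler_nat; near: n; exact: nbhs_infty_ge.
have n0 : 0 < n%:R :> R by apply: lt_le_trans n4.
have eps1 : lambda n / n%:R `^ (1 / 3) <= 1 by near: n; apply: (cvgr_le _ lambda_small).
pose r : R := n%:R `^ (1 / 3).
rewrite -/r in eps1.
have r0 : 0 < r by rewrite powR_gt0.
have r3 : r ^+ 3 = n%:R.
  by rewrite -powR_mulrn ?powR_ge0 // -powRrM div1r mulVf // powRr1 ?ltW.
(* The powers [6 ^ 4 = 1296 > 96] and [6 ^ 3 = 216 >= 144] turn this into both smallness conditions
   on [k]. *)
have k6 : 6 * k n <= 1.
  rewrite -[leRHS](@mulfV _ 6) // ler_wpM2l // ltW //.
  by near: n; apply: k_small; rewrite invr_gt0.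
rewrite powRN -/r; pose eps := lambda n / r; rewrite -/eps in eps1 *.
have eps0 : 0 < eps by rewrite divr_gt0.
have p01 : 0 <= 2 * (1 + eps) / n%:R <= 1.
  rewrite divr_ge0 ?mulr_ge0 ?addr_ge0 ?(ltW eps0) ?(ltW n0) //=.
  by rewrite ler_pdivrMr // mul1r; lra.
apply/andP; split; last first.
  rewrite -[leRHS](Pr_Gnp2_total n (2 * (1 + eps) / n%:R)).
  exact: (Pr_le p01).
have kn0 := k_gt0 n.
apply: (@Pr_not_adaptable_cap R n (r * k n)) => //.
- have : (6 * k n) ^+ 4 <= 1 by rewrite exprn_ile1 // mulr_ge0 // ltW.
  rewrite exprMn; move: (k n ^+ 4) (exprn_gt0 4 kn0) => x x0; lra.
- have : (6 * k n) ^+ 3 <= 1 by rewrite exprn_ile1 // mulr_ge0 // ltW.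
  rewrite exprMn; move: (k n ^+ 3) (exprn_gt0 3 kn0) => x x0; lra.
- by rewrite exprMn r3.
(* For [t >= 1]: [1 = k ^ 2 * lambda <= k ^ 2 * r <= k * r], using [lambda <= r] and [k <= 1]. *)
- have : lambda n <= r by move: eps1; rewrite ler_pdivrMr // mul1r.
  have := k2 n; move: (lambda n) (lambda_gt0 n) => l l0 kl lr.
  have : k n ^+ 2 * r >= 1 by rewrite -kl ler_wpM2l ?exprn_ge0 // ltW.
  move=> /le_trans; apply.
  rewrite (_ : k n ^+ 2 * r = k n * (r * k n)); last by ring.
  by rewrite ler_piMl ?(mulr_ge0 (ltW r0) (ltW kn0)) //; lra.
- rewrite /eps -[RHS](k2 n); field; exact: lt0r_neq0.
- by rewrite eps0.
Unshelve. all: by end_near.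
Qed.
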